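(* Let $M$ be a regular indecomposable module. Then the shift orbit $\{\sigma^tM : t\in\mathbb Z\}$ of $M$ contains a unique sink module $M_0$ with smallest possible radius; let $r_0=r_0(M)=r(M_0)$ and $M_i=\sigma^iM_0$ for all $i\in\mathbb Z$. Then $r_0\ge 1$, and there are an integer $b$ with $0\le b\le r_0$ and a path $(a_0,\dots,a_b)$ in $T(n)$ such that: (1) for every $i\ge 0$, $M_{-i}$ is a sink module with radius $r_0+i$ and center $a_0$; (2) for $1\le i\le b$, $M_i$ is a flow module with radius $r_0-1$ and center the edge $\{a_{i-1},a_i\}$; (3) for every $i\ge 0$, $M_{b+1+i}$ is a source module with radius $r_0+i$ and center $a_b$. Moreover, $a_0$ is a sink of the orientation of the quiver of which $M_0$ is a representation if $r_0$ is even, and a source of that orientation if $r_0$ is odd.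
   Context: Let $k$ be a field and $n\ge 3$ an integer. $T(n)$ denotes the $n$-regular tree (the infinite tree in which every vertex has exactly $n$ neighbours). A path of length $t\ge 0$ in $T(n)$ is a sequence $(a_0,\dots,a_t)$ of vertices with $a_{i-1},a_i$ neighbours for $1\le i\le t$ and $a_{i-1}\neq a_{i+1}$ for $1\le i<t$; $d(a,a')$ is the length of the unique path from $a$ to $a'$. A path of length $2r$ has center $a_r$ and radius $r$; a path of length $2r+1$ has center the edge $\{a_r,a_{r+1}\}$ and radius $r$. Fix a bipartite orientation $\Omega$ of $T(n)$ (every vertex is a sink or a source) and let $\sigma\Omega$ be the opposite orientation, $\sigma^2\Omega=\Omega$. A module is a finite-dimensional $k$-representation of the quiver $(T(n),\Omega)$ or of $(T(n),\sigma\Omega)$. The shift functor $\sigma$ is the composition of the Bernstein–Gelfand–Ponomarev reflection functors at all sinks; it maps $\mathrm{mod}(T(n),\Omega)\to\mathrm{mod}(T(n),\sigma\Omega)$ and $\mathrm{mod}(T(n),\sigma\Omega)\to\mathrm{mod}(T(n),\Omega)$; $\sigma^-$ denotes its left adjoint, and $\sigma^t$ for $t<0$ means $(\sigma^-)^{-t}$. An indecomposable module $M$ is regular if $\sigma^tM\neq 0$ for all $t\in\mathbb Z$. For an indecomposable module $M$, its support $T(M)$ is the full subgraph of $T(n)$ on the vertices $a$ with $M_a\neq 0$ (a finite tree). A diameter path of $M$ is a path in $T(M)$ of maximal length; this length is the diameter $d(M)$. All diameter paths of $M$ have the same center, called the center of $M$ (a vertex or an edge), and the radius of $M$ is $r(M)=\lfloor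 d(M)/2\rfloor$. $M$ is a sink module (resp. source module) if its diameter paths start and end in sinks (resp. sources) of the orientation of the quiver of which $M$ is a representation; $M$ is a flow module if $d(M)$ is odd. *)

(* Defs.v *)
From HB Require Import structures.
From mathcomp Require Import all_boot all_order all_algebra.
Set Implicit Arguments. Unset Strict Implicit. Unset Printing Implicit Defensive.
Import Order.TTheory GRing.Theory Num.Theory.
Local Open Scope ring_scope.

(* ---------- The n-regular tree T(n) ----------
   Vertices: reduced words over 'I_n (no two consecutive equal letters), i.e.
   elements of the free product of n copies of Z/2; the tree is its Cayley
   graph.  Words are stored with the most recent letter at the head. *)
Definition reduced (n : nat) (s : seq 'I_n) : bool := sorted (fun x y => x != y) s.

Definition vert (n : nat) := {s : seq 'I_n | reduced s}.

Definition nb_raw (n : nat) (s : seq 'I_n) (i : 'I_n) : seq 'I_n :=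
  if s is j :: s' then (if j == i then s' else i :: s) else [:: i].

Lemma nb_raw_reduced (n : nat) (s : seq 'I_n) (i : 'I_n) :
  reduced s -> reduced (nb_raw s i).
Proof.
case: s => [|j s'] //= H.
case: eqP => [_ | ne].
  by move: H; rewrite /reduced; case: s' => //= x s'' /andP [].
by rewrite /reduced /= H andbT; apply/eqP => E; apply: ne; rewrite E.
Qed.

Definition nb (n : nat) (a : vert n) (i : 'I_n) : vert n :=
  exist _ (nb_raw (val a) i) (nb_raw_reduced i (valP a)).

Definition troot (n : nat) : vert n := exist _ [::] isT.

Definition adj (n : nat) (a b : vert n) : bool := [exists i : 'I_n, nb a i == b].

(* ---------- Bipartite orientations ----------
   o = false is Omega (vertices of even word length are sinks),
   o = true is sigma Omega (vertices of odd word length are sinks). *)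
Definition is_sink (n : nat) (o : bool) (a : vert n) : bool := odd (size (val a)) == o.

Definition arrow (n : nat) (o : bool) (a b : vert n) : bool := adj a b && is_sink o b.

(* ---------- Representations ----------
   A representation of (T(n), o): a dimension at each vertex and, for every
   arrow a -> b, a linear map k^(dim a) -> k^(dim b) given by a matrix acting
   on row vectors (v |-> v *m rmap a b).  Entries rmap a b for non-arrows are
   irrelevant. *)
Record rep (k : fieldType) (n : nat) := Rep {
  rorient : bool;
  rdim : vert n -> nat;
  rmap : forall a b : vert n, 'M[k]_(rdim a, rdim b) }.

Definition finsupp (k : fieldType) (n : nat) (M : rep k n) : Prop :=
  exists s : seq (vert n), forall a, rdim M a != 0%N -> a \in s.

Definition is_zero (k : fieldType) (n : nat) (M : rep k n) : Prop :=
  forall a, rdim M a = 0%N.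

Definition mxget (k : fieldType) (r c : nat) (A : 'M[k]_(r, c)) (i j : nat) : k :=
  match (insub i : option 'I_r), (insub j : option 'I_c) with
  | Some i', Some j' => A i' j'
  | _, _ => 0
  end.

Section Shift.
Variables (k : fieldType) (n : nat) (M : rep k n).
Local Notation o := (rorient M).

(* ---- sigma : BGP reflection at all sinks ---- *)
Definition inmx (a : vert n) : 'M[k]_(\sum_(j < n) rdim M (nb a j), rdim M a) :=
  \mxcol_(j < n) rmap M (nb a j) a.

Definition projnb (a b : vert n) : 'M[k]_(\sum_(j < n) rdim M (nb a j), rdim M b) :=
  \mxcol_(j < n) (if nb a j == b then pid_mx (rdim M b) else 0).

Definition sig_dim (a : vert n) : nat :=
  if is_sink o a then \rank (kermx (inmx a)) else rdim M a.

Definition sig_map (x y : vert n) : 'M[k]_(sig_dim x, sig_dim y) :=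
  \matrix_(i < sig_dim x, j < sig_dim y)
    (if is_sink o x && ~~ is_sink o y then
       mxget (row_base (kermx (inmx x)) *m projnb x y) i j
     else 0).

Definition sigma : rep k n := Rep (~~ o) sig_map.

(* ---- sigma^- : BGP reflection at all sources ---- *)
Definition outmx (a : vert n) : 'M[k]_(rdim M a, \sum_(j < n) rdim M (nb a j)) :=
  \mxrow_(j < n) rmap M a (nb a j).

Definition injnb (a b : vert n) : 'M[k]_(rdim M b, \sum_(j < n) rdim M (nb a j)) :=
  \mxrow_(j < n) (if nb a j == b then pid_mx (rdim M b) else 0).

(* the quotient map (+)_j M_{nb a j} -> cokernel of outmx a *)
Definition cobase (a : vert n) :
  'M[k]_(\sum_(j < n) rdim M (nb a j), \rank (cokermx (outmx a))^T) :=
  (row_base (cokermx (outmx a))^T)^T.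

Definition sigm_dim (a : vert n) : nat :=
  if ~~ is_sink o a then \rank (cokermx (outmx a))^T else rdim M a.

Definition sigm_map (x y : vert n) : 'M[k]_(sigm_dim x, sigm_dim y) :=
  \matrix_(i < sigm_dim x, j < sigm_dim y)
    (if is_sink o x && ~~ is_sink o y then
       mxget (injnb y x *m cobase y) i j
     else 0).

Definition sigmam : rep k n := Rep (~~ o) sigm_map.

End Shift.

Definition shift_int (k : fieldType) (n : nat) (M : rep k n) (t : int) : rep k n :=
  match t with
  | Posz m => iter m (@sigma k n) M
  | Negz m => iter m.+1 (@sigmam k n) M
  end.

Definition indecomposable (k : fieldType) (n : nat) (M : rep k n) : Prop :=
  ~ is_zero M /\
  forall U V : forall a : vert n, 'M[k]_(rdim M a),
    (forall a, (U a :&: V a <= (0 : 'M[k]_(rdim M a)))%MS /\ (1%:M <= U a + V a)%MS) ->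
    (forall a b, arrow (rorient M) a b ->
        (U a *m rmap M a b <= U b)%MS /\ (V a *m rmap M a b <= V b)%MS) ->
    (forall a, (U a <= (0 : 'M[k]_(rdim M a)))%MS) \/
    (forall a, (V a <= (0 : 'M[k]_(rdim M a)))%MS).

Definition regular (k : fieldType) (n : nat) (M : rep k n) : Prop :=
  indecomposable M /\ forall t : int, ~ is_zero (shift_int M t).

(* a path of length t is a sequence of t+1 vertices *)
Definition is_path (n : nat) (p : seq (vert n)) : Prop :=
  [/\ (0 < size p)%N,
      (forall i, (i.+1 < size p)%N -> adj (nth (troot n) p i) (nth (troot n) p i.+1)) &
      (forall i, (i.+2 < size p)%N -> nth (troot n) p i != nth (troot n) p i.+2)].

Definition in_supp (k : fieldType) (n : nat) (M : rep k n) (p : seq (vert n)) : Prop :=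
  forall a, a \in p -> rdim M a != 0%N.

Definition diam_path (k : fieldType) (n : nat) (M : rep k n) (p : seq (vert n)) : Prop :=
  [/\ is_path p, in_supp M p &
      forall q, is_path q -> in_supp M q -> (size q <= size p)%N].

Definition sink_module (k : fieldType) (n : nat) (M : rep k n) (r : nat) : Prop :=
  (exists p, diam_path M p) /\
  forall p, diam_path M p ->
    [/\ size p = (2 * r).+1, is_sink (rorient M) (head (troot n) p)
      & is_sink (rorient M) (last (troot n) p)].

Definition source_module (k : fieldType) (n : nat) (M : rep k n) (r : nat) : Prop :=
  (exists p, diam_path M p) /\
  forall p, diam_path M p ->
    [/\ size p = (2 * r).+1, ~~ is_sink (rorient M) (head (troot n) p)
      & ~~ is_sink (rorient M) (last (troot n) p)].

Definition flow_module (k : fieldType) (n : nat) (M : rep k n) (r : nat) : Prop :=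
  (exists p, diam_path M p) /\
  forall p, diam_path M p -> size p = (2 * r).+2.

(* center a vertex c (for modules of even diameter 2r) *)
Definition vcenter (k : fieldType) (n : nat) (M : rep k n) (r : nat) (c : vert n) : Prop :=
  forall p, diam_path M p -> nth (troot n) p r = c.

(* center the edge {x, y} (for modules of odd diameter 2r+1) *)
Definition ecenter (k : fieldType) (n : nat) (M : rep k n) (r : nat) (x y : vert n) : Prop :=
  forall p, diam_path M p ->
    ((nth (troot n) p r == x) && (nth (troot n) p r.+1 == y)) ||
    ((nth (troot n) p r == y) && (nth (troot n) p r.+1 == x)).

(* Main.v *)
Require Import Defs.
From HB Require Import structures.
From mathcomp Require Import all_boot all_order all_algebra.
From mathcomp Require Import zify.
From Stdlib Require Import ClassicalEpsilon FunctionalExtensionality.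
Import Order.TTheory GRing.Theory Num.Theory.
Set Implicit Arguments. Unset Strict Implicit. Unset Printing Implicit Defensive.
Local Open Scope ring_scope.

(* Reflection functors along a regular orbit give short exact sequences
   [0 -> N_x -> (+)_j M_(nb x j) -> M_x -> 0] at the sinks [x] of [M], where [N] is
   the shift of [M].  Hence the supports [S_t] along the orbit obey a rule
   invariant under time reversal: [S_t] and [S_(t+1)] agree at sources, and a
   sink lies in their union iff it has a neighbour in [S_t].  Supports being
   convex subsets of the tree, it remains to follow center and radius under this
   rule.  A source module keeps its center and its radius grows by one; a flow
   module becomes a source module or a flow module whose center has moved one
   edge towards the source side; a sink module shrinks, or turns into a flow or
   source module.  A flow run of radius [R] has at most [R + 1] terms, since its
   center follows a path leading to a source end of the first term, beyond which
   the later supports branch. *)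

(** The sequences exist because the modules are indecomposable: if the map into some sink were not
    surjective, a projection at that vertex would split the module, leaving only a module
    concentrated there, whose shift is zero. Indecomposability in turn passes along the sequences in
    both directions, which keeps the induction over the orbit going. Exactness is recorded by
    componentwise kernel and cokernel properties, so that morphisms lift and descend without block
    matrices; as a relation between two modules it covers [sigma] and [sigmam] at once, although
    both depend on chosen bases. Convexity of supports is a second consequence of indecomposability.
    Two facts drive the tree argument. Sinks and sources alternate, so the parity of the distance
    from the center sharpens bounds by one. And every orbit reaches a source module; in reversed
    time this provides sink modules, of which the last one is [M_0]. *)

Record short_exact (k : fieldType) (n p q : nat) (d : 'I_n -> nat)
    (u : forall j, 'M[k]_(p, d j)) (i : forall j, 'M[k]_(d j, q)) : Prop :=
  ShortExact {
    se_comp : \sum_j u j *m i j = 0;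
    se_ker : forall m (v : forall j, 'M[k]_(m, d j)), \sum_j v j *m i j = 0 ->
      exists w, forall j, w *m u j = v j;
    se_mono : forall m (w : 'M[k]_(m, p)), (forall j, w *m u j = 0) -> w = 0;
    se_coker : forall m (v : forall j, 'M[k]_(d j, m)), \sum_j u j *m v j = 0 ->
      exists w, forall j, i j *m w = v j;
    se_epi : forall m (w : 'M[k]_(q, m)), (forall j, i j *m w = 0) -> w = 0;
    se_dim : (p + q)%N = (\sum_j d j)%N }.

Lemma mxcol_fullP (k : fieldType) (n q : nat) (d : 'I_n -> nat)
    (i : forall j, 'M[k]_(d j, q)) :
  row_full (\mxcol_j i j) <->
  forall m (w : 'M[k]_(q, m)), (forall j, i j *m w = 0) -> w = 0.
Proof.
split=> [fi m w iw0|H].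
  apply: (row_full_inj fi); rewrite mulmx0 mxcol_mul -[RHS](@mxcol0 _ _ d).
  by apply/eq_mxcolP => j; rewrite iw0.
rewrite -cokermx_eq0; apply/eqP/H => j.
have := mulmx_coker (\mxcol_j i j); rewrite mxcol_mul -[RHS]mxcol0.
by move=> /eq_mxcolP.
Qed.

Lemma mxrow_freeP (k : fieldType) (n p : nat) (d : 'I_n -> nat)
    (u : forall j, 'M[k]_(p, d j)) :
  row_free (\mxrow_j u j) <->
  forall m (w : 'M[k]_(m, p)), (forall j, w *m u j = 0) -> w = 0.
Proof.
split=> [fu m w wu0|H].
  apply: (row_free_inj fu); rewrite mul0mx mul_mxrow -[RHS](@mxrow0 _ _ d).
  by apply/eq_mxrowP => j; rewrite wu0.
rewrite -kermx_eq0; apply/eqP/H => j.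
have := mulmx_ker (\mxrow_j u j); rewrite mul_mxrow -[RHS]mxrow0.
by move=> /eq_mxrowP.
Qed.

Lemma short_exact_mx (k : fieldType) (n p q : nat) (d : 'I_n -> nat)
    (u : forall j, 'M[k]_(p, d j)) (i : forall j, 'M[k]_(d j, q)) :
  row_free (\mxrow_j u j) -> row_full (\mxcol_j i j) ->
  \sum_j u j *m i j = 0 -> (p + q)%N = (\sum_j d j)%N -> short_exact u i.
Proof.
set U := \mxrow_j u j; set I := \mxcol_j i j => fU fI ui0 dimE.
have UI0 : U *m I = 0 by rewrite mul_mxrow_mxcol.
have kerU : (kermx I <= U)%MS.
  have /sub_kermxP sUK := UI0.
  have [_ /esym] := mxrank_leqif_sup sUK => ->.
  rewrite mxrank_ker (eqP fU) (eqP fI); apply/eqP; lia.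
split=> // [m v vi0|m w wu0|m v uv0|m w iw0].
- have /sub_kermxP sVK : \mxrow_j v j *m I = 0 by rewrite mul_mxrow_mxcol.
  have /submxP [w wE] := submx_trans sVK kerU.
  exists w => j; move: wE; rewrite mul_mxrow => /eq_mxrowP /(_ j) ->; by [].
- by move/mxrow_freeP: fU; apply.
(* [pinvmx I] is a section of the surjection [I], so [1 - I *m pinvmx I] has its rows in the kernel
   of [I], that is in [U], which the family [v] kills. *)
- exists (pinvmx I *m \mxcol_j v j) => j.
  have UV0 : U *m \mxcol_j v j = 0 by rewrite mul_mxrow_mxcol.
  have sK : (1%:M - I *m pinvmx I <= U)%MS.
    apply: submx_trans kerU; apply/sub_kermxP.
    by rewrite mulmxBl mul1mx -mulmxA mulVpmx // mulmx1 subrr.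
  have /submxP [D DE] := sK.
  have : I *m (pinvmx I *m \mxcol_j v j) = \mxcol_j v j.
    apply/eqP; rewrite -subr_eq0 -opprB oppr_eq0 mulmxA -{1}[\mxcol_j v j]mul1mx.
    by rewrite -mulmxBl DE -mulmxA UV0 mulmx0.
  by rewrite mxcol_mul => /eq_mxcolP /(_ j).
- by move/mxcol_fullP: fI; apply.
Qed.

Lemma nb_involutive (n : nat) (a : vert n) (i : 'I_n) : nb (nb a i) i = a.
Proof.
apply: val_inj; case: a => [[|j s] /= H]; first by rewrite eqxx.
case: eqP => [<-|ne] /=; last by rewrite eqxx.
case: s H => [|l s] //=; rewrite /reduced /= => /andP [jl _].
by rewrite eq_sym (negbTE jl).
Qed.

Lemma is_sink_nb (n : nat) o (a : vert n) (i : 'I_n) :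
  is_sink o (nb a i) = ~~ is_sink o a.
Proof.
rewrite /is_sink /=; case: a => [[|j s] /= _]; first by case: o.
by case: (j =P i) => _ /=; case: (odd _); case: o.
Qed.

Lemma is_sinkN (n : nat) o (a : vert n) : is_sink (~~ o) a = ~~ is_sink o a.
Proof. by rewrite /is_sink; case: o; case: odd. Qed.

Lemma nb_inj (n : nat) (a : vert n) : injective (nb a).
Proof.
move=> i j /(congr1 val); case: a => [[|l s] /= _]; first by case.
case: (l =P i) => [<-|_]; case: (l =P j) => [<-|_] //.
- by move/(congr1 size) => /=; rewrite ?addn1; lia.
- by move/(congr1 size) => /=; rewrite ?addn1; lia.
- by case.
Qed.

Lemma adj_sym (n : nat) (a b : vert n) : adj a b = adj b a.
Proof.
by apply/existsP/existsP => -[i /eqP <-]; exists i; rewrite nb_involutive.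
Qed.

(** * Morphisms, idempotents and their transfer along exact sequences *)

Section Hom.
Variables (k : fieldType) (n : nat).
Implicit Types M N : rep k n.

Definition mxfamily M N := forall a, 'M[k]_(rdim M a, rdim N a).

Definition hom M N (f : mxfamily M N) : Prop :=
  forall a b, arrow (rorient M) a b -> f a *m rmap N a b = rmap M a b *m f b.

Definition idfam M : mxfamily M M := fun a => 1%:M.

Definition compfam M N P (f : mxfamily M N) (g : mxfamily N P) : mxfamily M P :=
  fun a => f a *m g a.

Lemma hom_id M : hom (idfam M).
Proof. by move=> a b _; rewrite mul1mx mulmx1. Qed.

Lemma hom_comp M N P (f : mxfamily M N) (g : mxfamily N P) :
  rorient N = rorient M -> hom f -> hom g -> hom (compfam f g).
Proof.
move=> oE hf hg a b ab; rewrite /compfam -mulmxA hg ?oE // !mulmxA.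
by congr (_ *m _); exact: hf.
Qed.

Definition iso M N : Prop := rorient N = rorient M /\
  exists (f : mxfamily M N) (g : mxfamily N M), [/\ hom f, hom g &
    forall a, f a *m g a = 1%:M /\ g a *m f a = 1%:M].

Lemma iso_refl M : iso M M.
Proof.
split=> //; exists (idfam M), (idfam M); split; try exact: hom_id.
by move=> a; rewrite mul1mx.
Qed.

Lemma iso_dim M N : iso M N -> rdim M =1 rdim N.
Proof.
move=> [_ [f [g [_ _ fg]]]] a; have [/mulmx1_min h1 /mulmx1_min h2] := fg a; lia.
Qed.

(* Splittings of [M] are encoded by idempotent endomorphisms. *)
Definition indec M : Prop := forall e : mxfamily M M, hom e ->
  (forall a, e a *m e a = e a) ->
  (forall a, e a = 0) \/ (forall a, e a = 1%:M).

(** The images of [e] and of [1 - e] are complementary subrepresentations. *)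
Lemma indecomposable_indec M : indecomposable M -> indec M.
Proof.
move=> [_ iM] e he ee; case: (iM e (fun a => 1%:M - e a)).
- move=> a; split.
    apply/rV_subP => v; rewrite sub_capmx => /andP [/submxP [w ->] /submxP [z E]].
    by rewrite -ee mulmxA E -mulmxA mulmxBl mul1mx ee subrr mulmx0 sub0mx.
  have E : 1%:M = e a + (1%:M - e a) by rewrite addrC subrK.
  by rewrite {1}E; apply: addmx_sub_adds.
- move=> a b ab; split; first by rewrite he // submxMl.
  by rewrite mulmxBl mul1mx he // -{1}[rmap M a b]mulmx1 -mulmxBr submxMl.
- by move=> h; left=> a; apply/eqP; rewrite -submx0.
- move=> h; right=> a; apply/esym/eqP; rewrite -subr_eq0 -submx0; exact: h.
Qed.

(* The families [g], [h] identify [M] and [N] at the sources of [M]; at a sink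
   [x] the maps out of [N_x] and into [M_x] form a short exact sequence
   [0 -> N_x -> (+)_j M_(nb x j) -> M_x -> 0].  The relation is self-dual. *)
Record ses_with M N (g : mxfamily M N) (h : mxfamily N M) : Prop := SesWith {
  ses_orient : rorient N = ~~ rorient M;
  ses_idl : forall a, ~~ is_sink (rorient M) a -> g a *m h a = 1%:M;
  ses_idr : forall a, ~~ is_sink (rorient M) a -> h a *m g a = 1%:M;
  ses_exact : forall x, is_sink (rorient M) x ->
    short_exact (fun j => rmap N x (nb x j) *m h (nb x j))
                (fun j => rmap M (nb x j) x) }.

Definition ses M N : Prop := exists g h, @ses_with M N g h.

Lemma dchoice (T : Type) (U : T -> Type) (P : forall a, U a -> Prop) :
  (forall a, exists u, P a u) -> exists f, forall a, P a (f a).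
Proof.
move=> H; exists (fun a => proj1_sig (constructive_indefinite_description _ (H a))).
move=> a; exact: proj2_sig.
Qed.

Section Transfer.
Variables (M N M' N' : rep k n).
Variables (g : mxfamily M N) (h : mxfamily N M) (g' : mxfamily M' N') (h' : mxfamily N' M').
Hypothesis s : ses_with g h.
Hypothesis s' : ses_with g' h'.
Hypothesis oE : rorient M' = rorient M.

Let arrowN (y x : vert n) : arrow (rorient N) y x ->
  exists j, [/\ x = nb y j, is_sink (rorient M) y & ~~ is_sink (rorient M) x].
Proof.
rewrite /arrow (ses_orient s) is_sinkN => /andP [/existsP [j /eqP <-] hx].
by exists j; split=> //; move: hx; rewrite is_sink_nb negbK.
Qed.

Let arrowM (y x : vert n) : arrow (rorient M) y x ->
  exists j, [/\ y = nb x j, is_sink (rorient M) x & ~~ is_sink (rorient M) y].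
Proof.
rewrite /arrow adj_sym => /andP [/existsP [j /eqP <-] hx].
by exists j; split=> //; rewrite is_sink_nb hx.
Qed.

Let arrow_nb (x : vert n) j : is_sink (rorient M) x -> arrow (rorient M) (nb x j) x.
Proof. by move=> hx; rewrite /arrow hx adj_sym andbT; apply/existsP; exists j. Qed.

Let arrow_nbN (x : vert n) j : is_sink (rorient M) x -> arrow (rorient N) x (nb x j).
Proof.
move=> hx; rewrite /arrow (ses_orient s) is_sinkN is_sink_nb hx andbT.
by apply/existsP; exists j.
Qed.

Let src (x : vert n) j : is_sink (rorient M) x -> ~~ is_sink (rorient M) (nb x j).
Proof. by rewrite is_sink_nb => ->. Qed.

(** At a sink, [f] maps the middle term and the cokernel of one sequence to those of the other,
    hence induces a map of kernels; this is the missing component of [f']. *)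
Lemma hom_to_ses (f : mxfamily M M') : hom f ->
  exists f' : mxfamily N N', hom f' /\
    forall a, ~~ is_sink (rorient M) a -> f' a = h a *m f a *m g' a.
Proof.
move=> hf.
pose P a (w : 'M[k]_(rdim N a, rdim N' a)) :=
  if is_sink (rorient M) a then
    forall j, w *m (rmap N' a (nb a j) *m h' (nb a j))
              = rmap N a (nb a j) *m h (nb a j) *m f (nb a j)
  else w = h a *m f a *m g' a.
have [|f' Pf'] := @dchoice _ _ P.
  move=> x; rewrite /P; case hx: (is_sink (rorient M) x); last by eexists.
  have hx' : is_sink (rorient M') x by rewrite oE.
  apply: (se_ker (ses_exact s' hx')) => /=.
  have E j : rmap N x (nb x j) *m h (nb x j) *m f (nb x j) *m rmap M' (nb x j) x
     = rmap N x (nb x j) *m h (nb x j) *m rmap M (nb x j) x *m f x.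
    by rewrite -!mulmxA hf ?arrow_nb.
  by rewrite (eq_bigr _ (fun j _ => E j)) -mulmx_suml (se_comp (ses_exact s hx)) mul0mx.
exists f'; split.
  move=> x y /arrowN [j [-> hx hy]]; have := Pf' x; have := Pf' (nb x j).
  rewrite /P hx (negbTE hy) => -> /(_ j) E.
  rewrite !mulmxA -E -!mulmxA (ses_idr s') ?oE // mulmx1; by [].
by move=> a ha; have := Pf' a; rewrite /P (negbTE ha).
Qed.

(** Dual of the previous lift: the component at a sink is induced on cokernels. *)
Lemma hom_of_ses (f' : mxfamily N N') : hom f' ->
  exists f : mxfamily M M', hom f /\
    forall a, ~~ is_sink (rorient M) a -> f a = g a *m f' a *m h' a.
Proof.
move=> hf.
pose P a (w : 'M[k]_(rdim M a, rdim M' a)) :=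
  if is_sink (rorient M) a then
    forall j, rmap M (nb a j) a *m w
              = g (nb a j) *m f' (nb a j) *m h' (nb a j) *m rmap M' (nb a j) a
  else w = g a *m f' a *m h' a.
have [|f Pf] := @dchoice _ _ P.
  move=> x; rewrite /P; case hx: (is_sink (rorient M) x); last by eexists.
  have hx' : is_sink (rorient M') x by rewrite oE.
  apply: (se_coker (ses_exact s hx)) => /=.
  have E j : rmap N x (nb x j) *m h (nb x j) *m
      (g (nb x j) *m f' (nb x j) *m h' (nb x j) *m rmap M' (nb x j) x)
     = f' x *m (rmap N' x (nb x j) *m h' (nb x j) *m rmap M' (nb x j) x).
    rewrite !mulmxA -(mulmxA _ (h _)) (ses_idr s) ?src // mulmx1.
    by rewrite -(hf x (nb x j)) ?arrow_nbN.
  by rewrite (eq_bigr _ (fun j _ => E j)) -mulmx_sumr (se_comp (ses_exact s' hx')) mulmx0.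
exists f; split.
  move=> y x /arrowM [j [-> hx hy]]; have := Pf x; have := Pf (nb x j).
  by rewrite /P hx (negbTE hy) => -> /(_ j) ->.
by move=> a ha; have := Pf a; rewrite /P (negbTE ha).
Qed.

(** The maps into a sink are jointly epic, so the components at sources determine the rest; on the
    side of [N], joint monicity plays the same part. *)
Lemma hom_eq_l (f1 f2 : mxfamily M M') : hom f1 -> hom f2 ->
  (forall a, ~~ is_sink (rorient M) a -> f1 a = f2 a) -> forall a, f1 a = f2 a.
Proof.
move=> h1 h2 E x; case hx: (is_sink (rorient M) x); last by apply: E; rewrite hx.
apply/eqP; rewrite -subr_eq0; apply/eqP; apply: (se_epi (ses_exact s hx)) => j /=.
by rewrite mulmxBr -h1 ?arrow_nb // -h2 ?arrow_nb // E ?src // subrr.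
Qed.

Lemma hom_eq_r (f1 f2 : mxfamily N N') : hom f1 -> hom f2 ->
  (forall a, ~~ is_sink (rorient M) a -> f1 a = f2 a) -> forall a, f1 a = f2 a.
Proof.
move=> h1 h2 E x; case hx: (is_sink (rorient M) x); last by apply: E; rewrite hx.
have hx' : is_sink (rorient M') x by rewrite oE.
apply/eqP; rewrite -subr_eq0; apply/eqP; apply: (se_mono (ses_exact s' hx')) => j /=.
by rewrite mulmxBl !mulmxA h1 ?arrow_nbN // h2 ?arrow_nbN // E ?src // subrr.
Qed.

End Transfer.

(** The lifts of two inverse morphisms are inverse at the sources, hence everywhere. Thus each term
    of a sequence determines the other up to isomorphism, whatever bases were chosen. *)
Lemma ses_iso_r M N M' N' : ses M N -> ses M' N' -> iso M M' -> iso N N'.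
Proof.
move=> [g [h s]] [g' [h' s']] [oE [f [f' [hf hf' ff']]]].
have oNE : rorient N' = rorient N by rewrite (ses_orient s) (ses_orient s') oE.
have [u [hu uE]] := hom_to_ses s s' oE hf.
have [v [hv vE]] := hom_to_ses s' s (esym oE) hf'.
split=> //; exists u, v; split=> // a; split.
- apply: (hom_eq_r s s (erefl _) (f1 := compfam u v) (f2 := idfam N)).
  + exact: hom_comp. + exact: hom_id.
  + move=> b hb; rewrite /compfam /idfam uE // vE ?oE // !mulmxA.
    rewrite -(mulmxA _ (g' b)) (ses_idl s') ?oE // mulmx1 -(mulmxA _ (f b)).
    by case: (ff' b) => -> _; rewrite mulmx1 (ses_idr s).
- apply: (hom_eq_r s' s' (erefl _) (f1 := compfam v u) (f2 := idfam N')).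
  + exact: hom_comp. + exact: hom_id.
  + move=> b; rewrite oE => hb; rewrite /compfam /idfam uE // vE ?oE // !mulmxA.
    rewrite -(mulmxA _ (g b)) (ses_idl s) // mulmx1 -(mulmxA _ (f' b)).
    by case: (ff' b) => _ ->; rewrite mulmx1 (ses_idr s') ?oE.
Qed.

Lemma ses_iso_l M N M' N' : ses M N -> ses M' N' -> iso N N' -> iso M M'.
Proof.
move=> [g [h s]] [g' [h' s']] [oNE [f [f' [hf hf' ff']]]].
have oE : rorient M' = rorient M.
  by move: oNE; rewrite (ses_orient s) (ses_orient s') => /negb_inj.
have [u [hu uE]] := hom_of_ses s s' oE hf.
have [v [hv vE]] := hom_of_ses s' s (esym oE) hf'.
split=> //; exists u, v; split=> // a; split.
- apply: (hom_eq_l s (f1 := compfam u v) (f2 := idfam M)).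
  + exact: hom_comp. + exact: hom_id.
  + move=> b hb; rewrite /compfam /idfam uE // vE ?oE // !mulmxA.
    rewrite -(mulmxA _ (h' b)) (ses_idr s') ?oE // mulmx1 -(mulmxA _ (f b)).
    by case: (ff' b) => -> _; rewrite mulmx1 (ses_idl s).
- apply: (hom_eq_l s' (f1 := compfam v u) (f2 := idfam M')).
  + exact: hom_comp. + exact: hom_id.
  + move=> b; rewrite oE => hb; rewrite /compfam /idfam uE // vE ?oE // !mulmxA.
    rewrite -(mulmxA _ (h b)) (ses_idr s) // mulmx1 -(mulmxA _ (f' b)).
    by case: (ff' b) => _ ->; rewrite mulmx1 (ses_idl s') ?oE.
Qed.

(** An idempotent of [N] descends to an idempotent of [M], which is 0 or 1; read back at the
    sources, this settles the idempotent of [N]. *)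
Lemma ses_indec_r M N : ses M N -> indec M -> indec N.
Proof.
move=> [g [h s]] iM e he ee.
have [f [hf fE]] := hom_of_ses s s (erefl _) he.
have ff a : f a *m f a = f a.
  apply: (hom_eq_l s (f1 := compfam f f)) => //; first exact: hom_comp.
  move=> b hb; rewrite /compfam fE // !mulmxA -(mulmxA _ (h b)) (ses_idr s) //.
  by rewrite mulmx1 -(mulmxA _ (e b) (e b)) ee.
have eE b : ~~ is_sink (rorient M) b -> e b = h b *m f b *m g b.
  move=> hb; rewrite fE // !mulmxA (ses_idr s) // mul1mx -mulmxA (ses_idr s) //.
  by rewrite mulmx1.
case: (iM f hf ff) => fa; [left|right].
- apply: (hom_eq_r s s (erefl _) (f2 := fun a => 0)) => //.
    by move=> a b _; rewrite mul0mx mulmx0.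
  by move=> b hb; rewrite eE // fa mulmx0 mul0mx.
- apply: (hom_eq_r s s (erefl _) (f2 := idfam N)) => //; first exact: hom_id.
  by move=> b hb; rewrite eE // fa mulmx1 (ses_idr s).
Qed.

Lemma ses_indec_l M N : ses M N -> indec N -> indec M.
Proof.
move=> [g [h s]] iN e he ee.
have [f [hf fE]] := hom_to_ses s s (erefl _) he.
have ff a : f a *m f a = f a.
  apply: (hom_eq_r s s (erefl _) (f1 := compfam f f)) => //; first exact: hom_comp.
  move=> b hb; rewrite /compfam fE // !mulmxA -(mulmxA _ (g b)) (ses_idl s) //.
  by rewrite mulmx1 -(mulmxA _ (e b) (e b)) ee.
have eE b : ~~ is_sink (rorient M) b -> e b = g b *m f b *m h b.
  move=> hb; rewrite fE // !mulmxA (ses_idl s) // mul1mx -mulmxA (ses_idl s) //.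
  by rewrite mulmx1.
case: (iN f hf ff) => fa; [left|right].
- apply: (hom_eq_l s (f2 := fun a => 0)) => //.
    by move=> a b _; rewrite mul0mx mulmx0.
  by move=> b hb; rewrite eE // fa mulmx0 mul0mx.
- apply: (hom_eq_l s (f2 := idfam M)) => //; first exact: hom_id.
  by move=> b hb; rewrite eE // fa mulmx1 (ses_idl s).
Qed.

End Hom.

(** The dimensions of a reflected module agree with the expected ones only after deciding whether
    the vertex is a sink. Truncated identities [pid_mx] serve as transports between such equal
    dimensions, and [mxget] is the entrywise form of this transport. *)
Lemma mxget_pid (k : fieldType) r c r' c' (A : 'M[k]_(r, c)) : r = r' -> c = c' ->
  \matrix_(i < r', j < c') mxget A i j = pid_mx r *m A *m pid_mx c.
Proof.
move=> <- <-; rewrite !pid_mx_1 mul1mx mulmx1; apply/matrixP => i j.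
by rewrite mxE /mxget !valK.
Qed.

Lemma pid_mxK (k : fieldType) m m' : m = m' ->
  (pid_mx m : 'M[k]_(m, m')) *m (pid_mx m : 'M[k]_(m', m)) = 1%:M /\
  (pid_mx m : 'M[k]_(m', m)) *m (pid_mx m : 'M[k]_(m, m')) = 1%:M.
Proof. by move=> <-; rewrite pid_mx_1 mulmx1. Qed.

Lemma short_exact_iso (k : fieldType) (n p q : nat) (d d' : 'I_n -> nat)
    (u : forall j, 'M[k]_(p, d j)) (i : forall j, 'M[k]_(d j, q))
    (u' : forall j, 'M[k]_(p, d' j)) (i' : forall j, 'M[k]_(d' j, q))
    (g : forall j, 'M[k]_(d' j, d j)) (h : forall j, 'M[k]_(d j, d' j)) :
  (forall j, g j *m h j = 1%:M) -> (forall j, h j *m g j = 1%:M) ->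
  (forall j, u' j = u j *m h j) -> (forall j, i' j = g j *m i j) ->
  short_exact u i -> short_exact u' i'.
Proof.
move=> gh hg uE iE; have -> : u' = fun j => u j *m h j by exact: functional_extensionality_dep.
have -> : i' = fun j => g j *m i j by exact: functional_extensionality_dep.
move=> [comp ker mono coker epi dimE]; split.
- rewrite -[RHS]comp; apply: eq_bigr => j _.
  by rewrite mulmxA -(mulmxA _ (h j)) hg mulmx1.
- move=> m v v0; have [|w wE] := ker m (fun j => v j *m g j).
    by rewrite -[RHS]v0; apply: eq_bigr => j _; rewrite mulmxA.
  by exists w => j; rewrite mulmxA wE -mulmxA gh mulmx1.
- move=> m w w0; apply: mono => j.
  by rewrite -[u j]mulmx1 -(hg j) mulmxA mulmxA -(mulmxA w) w0 mul0mx.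
- move=> m v v0; have [|w wE] := coker m (fun j => h j *m v j).
    by rewrite -[RHS]v0; apply: eq_bigr => j _; rewrite mulmxA.
  by exists w => j; rewrite -mulmxA wE mulmxA gh mul1mx.
- move=> m w w0; apply: epi => j.
  by rewrite -[i j]mul1mx -(hg j) -!mulmxA (mulmxA (g j)) w0 mulmx0.
- rewrite dimE; apply: eq_bigr => j _.
  have := mulmx1_min (gh j); have := mulmx1_min (hg j); lia.
Qed.

Lemma row_full_tr (k : fieldType) m p (A : 'M[k]_(m, p)) : row_full A^T = row_free A.
Proof. by rewrite /row_full mxrank_tr. Qed.

Lemma mulmx_sub_coker (k : fieldType) m p q (A : 'M[k]_(m, p)) (B : 'M[k]_(q, p)) :
  (B <= (cokermx A)^T)%MS -> A *m B^T = 0.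
Proof.
by move=> /submxP [D ->]; rewrite trmx_mul trmxK mulmxA mulmx_coker mul0mx.
Qed.

Lemma mx_dim0 (k : fieldType) m : 1%:M = 0 :> 'M[k]_m -> m = 0%N.
Proof. by move/(congr1 (@mxrank _ _ _)); rewrite mxrank1 mxrank0. Qed.

(** * Exact sequences along the orbit of a regular module *)

Section Orbit.
Variables (k : fieldType) (n : nat).
Implicit Types M N : rep k n.

Lemma mul_projnb M m (x : vert n) j
    (A : 'M[k]_(m, \sum_(j < n) rdim M (nb x j))) :
  A *m projnb M x (nb x j) = submxrow A j.
Proof.
rewrite -{1}[A]submxrowK mul_mxrow_mxcol (bigD1 j) //= eqxx pid_mx_1 mulmx1.
by rewrite big1 ?addr0 // => i ij; rewrite (inj_eq (@nb_inj _ _)) (negbTE ij) mulmx0.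
Qed.

Lemma mul_injnb M m (x : vert n) j
    (A : 'M[k]_(\sum_(j < n) rdim M (nb x j), m)) :
  injnb M x (nb x j) *m A = submxcol A j.
Proof.
rewrite -{1}[A]submxcolK mul_mxrow_mxcol (bigD1 j) //= eqxx pid_mx_1 mul1mx.
by rewrite big1 ?addr0 // => i ij; rewrite (inj_eq (@nb_inj _ _)) (negbTE ij) mul0mx.
Qed.

Definition onto_sinks M := forall x, is_sink (rorient M) x -> row_full (inmx M x).
Definition into_sources M := forall x, ~~ is_sink (rorient M) x -> row_free (outmx M x).

Lemma ses_sigma M : onto_sinks M -> ses M (sigma M).
Proof.
move=> oM.
have dE a : ~~ is_sink (rorient M) a -> rdim M a = rdim (sigma M) a.
  by move=> ha; rewrite /= /sig_dim (negbTE ha).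
exists (fun a => pid_mx (rdim M a)), (fun a => pid_mx (rdim M a)); split=> //.
- by move=> a ha; have [] := pid_mxK k (dE _ ha).
- by move=> a ha; have [] := pid_mxK k (dE _ ha).
- move=> x hx.
  have hy j : ~~ is_sink (rorient M) (nb x j) by rewrite is_sink_nb hx.
  set K := row_base (kermx (inmx M x)).
  have rE : \rank (kermx (inmx M x)) = sig_dim M x by rewrite /sig_dim hx.
  have rE' : \rank (kermx (inmx M x)) = rdim (sigma M) x by exact: rE.
  pose c : 'M[k]_(rdim (sigma M) x, \rank (kermx (inmx M x))) :=
    pid_mx (\rank (kermx (inmx M x))).
  have uE j : rmap (sigma M) x (nb x j) *m pid_mx (rdim M (nb x j)) =
      submxrow (c *m K) j.
    have -> : rmap (sigma M) x (nb x j) = c *m submxrow K j *m pid_mx (rdim M (nb x j)).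
      rewrite -mul_projnb /= /sig_map; apply/matrixP => a b.
      rewrite mxE hx hy /=.
      have /matrixP /(_ a b) := mxget_pid (K *m projnb M x (nb x j)) rE (dE _ (hy j)).
      by rewrite mxE.
    rewrite -mulmxA; have [-> _] := pid_mxK k (dE _ (hy j)).
    by rewrite mulmx1 mul_submxrow.
  have fc : row_free c by rewrite /row_free /c rank_pid_mx rE'.
  have UE : \mxrow_j (rmap (sigma M) x (nb x j) *m pid_mx (rdim M (nb x j))) = c *m K.
    by rewrite -[RHS]submxrowK; apply/eq_mxrowP => j; exact: uE.
  have rF := oM x hx.
  apply: short_exact_mx => //=.
  + by rewrite UE /row_free mxrankMfree ?row_base_free.
  + rewrite -mul_mxrow_mxcol UE -mulmxA.
    have /sub_kermxP -> : (K <= kermx (inmx M x))%MS by rewrite eq_row_base.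
    by rewrite mulmx0.
  + rewrite -rE mxrank_ker (eqP rF); have := rank_leq_row (inmx M x); rewrite (eqP rF); exact: subnK.
Qed.

Lemma ses_sigmam N : into_sources N -> ses (sigmam N) N.
Proof.
move=> iN.
have dE a : is_sink (rorient N) a -> rdim N a = rdim (sigmam N) a.
  by move=> ha; rewrite /= /sigm_dim ha.
exists (fun a => pid_mx (rdim N a)), (fun a => pid_mx (rdim N a)).
split; rewrite /= ?negbK //.
- by move=> a; rewrite is_sinkN negbK => ha; have [] := pid_mxK k (dE _ ha).
- by move=> a; rewrite is_sinkN negbK => ha; have [] := pid_mxK k (dE _ ha).
- move=> x; rewrite is_sinkN => hx.
  have hy j : is_sink (rorient N) (nb x j) by rewrite is_sink_nb.
  set K := cobase N x.
  have rE : \rank (cokermx (outmx N x))^T = sigm_dim N x by rewrite /sigm_dim hx.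
  have rE' : \rank (cokermx (outmx N x))^T = rdim (sigmam N) x by exact: rE.
  pose c : 'M[k]_(\rank (cokermx (outmx N x))^T, rdim (sigmam N) x) :=
    pid_mx (\rank (cokermx (outmx N x))^T).
  have iE j : sigm_map N (nb x j) x = pid_mx (rdim N (nb x j)) *m submxcol (K *m c) j.
    rewrite -submxcol_mul mulmxA -mul_injnb; apply/matrixP => a b.
    rewrite mxE hx hy /=.
    have /matrixP /(_ a b) := mxget_pid (injnb N x (nb x j) *m K) (dE _ (hy j)) rE.
    by rewrite mxE.
  have fc : row_full c by rewrite /row_full /c rank_pid_mx rE'.
  have sE : short_exact (fun j => rmap N x (nb x j)) (submxcol (K *m c)).
    have fO := iN x hx.
    apply: short_exact_mx => //.
    + have fK : row_full K by rewrite row_full_tr row_base_free.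
      by rewrite submxcolK /row_full (eqmxMfull _ fK).
    + rewrite -mul_mxrow_mxcol submxcolK mulmxA.
      by rewrite /K /cobase mulmx_sub_coker ?mul0mx // eq_row_base.
    + rewrite -rE' mxrank_tr mxrank_coker (eqP fO).
      have := rank_leq_col (outmx N x); rewrite (eqP fO); exact: subnKC.
  apply: (short_exact_iso (h := fun j => pid_mx (rdim N (nb x j))) _ _ _ iE sE) => // j.
  + by have [] := pid_mxK k (dE _ (hy j)).
  + by have [] := pid_mxK k (dE _ (hy j)).
Qed.

(** The projection onto the image of the incoming map at the sink [x], with the identity elsewhere,
    is an idempotent endomorphism. If it is 1, the map is surjective; if it is 0, [M] lives at [x]
    alone and [sigma M] vanishes. *)
Lemma sigma_onto M : indec M -> ~ is_zero (sigma M) -> onto_sinks M.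
Proof.
move=> iM nz x hx.
pose e : mxfamily M M := fun a =>
  if a == x then pinvmx (inmx M a) *m inmx M a else 1%:M.
have he : hom e.
  move=> a b /andP []; rewrite adj_sym => /existsP [j /eqP <-] hb.
  have -> : e (nb b j) = 1%:M.
    rewrite /e; case: eqP => // E; move: (is_sink_nb (rorient M) b j).
    by rewrite E hx hb.
  rewrite mul1mx /e; case: eqP => _; last by rewrite mulmx1.
  have : inmx M b *m (pinvmx (inmx M b) *m inmx M b) = inmx M b.
    by rewrite mulmxA mulmxKpV.
  by rewrite {1 4}/inmx mxcol_mul => /eq_mxcolP /(_ j).
have ee a : e a *m e a = e a.
  rewrite /e; case: eqP => _; last by rewrite mul1mx.
  by rewrite mulmxA mulmxKpV // submxMl.
case: (iM e he ee) => E; last first.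
  have := E x; rewrite /e eqxx => E1; apply/row_fullP; by eexists; exact: E1.
case: nz => a.
have Z b : b != x -> rdim M b = 0%N.
  by move=> bx; apply: (@mx_dim0 k); rewrite -(E b) /e (negbTE bx).
rewrite /= /sig_dim; case: ifP => ha; last first.
  by apply: Z; apply/eqP => ax; rewrite ax hx in ha.
apply/eqP; rewrite -leqn0; apply: leq_trans (rank_leq_row _) _.
rewrite leqn0 sum_nat_eq0; apply/forallP => j; apply/implyP => _; apply/eqP/Z.
by apply/eqP => jx; move: (is_sink_nb (rorient M) a j); rewrite jx hx ha.
Qed.

(** Dual argument: [outmx M x *m pinvmx (outmx M x)] is an idempotent that is 1 only when the
    outgoing map is injective. *)
Lemma sigmam_into M : indec M -> ~ is_zero (sigmam M) -> into_sources M.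
Proof.
move=> iM nz x hx.
pose e : mxfamily M M := fun a =>
  if a == x then outmx M a *m pinvmx (outmx M a) else 1%:M.
have he : hom e.
  move=> a b /andP [/existsP [j /eqP <-] hb].
  have -> : e (nb a j) = 1%:M.
    by rewrite /e; case: eqP => // E; rewrite -E hb in hx.
  rewrite mulmx1 /e; case: eqP => _; last by rewrite mul1mx.
  have : outmx M a *m pinvmx (outmx M a) *m outmx M a = outmx M a.
    by rewrite mulmxKpV.
  by rewrite {3 4}/outmx mul_mxrow => /eq_mxrowP /(_ j).
have ee a : e a *m e a = e a.
  rewrite /e; case: eqP => _; last by rewrite mul1mx.
  by rewrite mulmxA mulmxKpV.
case: (iM e he ee) => E; last first.
  have := E x; rewrite /e eqxx => E1; apply/row_freeP; by eexists; exact: E1.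
case: nz => a.
have Z b : b != x -> rdim M b = 0%N.
  by move=> bx; apply: (@mx_dim0 k); rewrite -(E b) /e (negbTE bx).
rewrite /= /sigm_dim; case: ifP => ha; last first.
  by apply: Z; apply/eqP => ax; rewrite ax hx in ha.
apply/eqP; rewrite -leqn0; apply: leq_trans (rank_leq_col _) _.
rewrite leqn0 sum_nat_eq0; apply/forallP => j; apply/implyP => _; apply/eqP/Z.
by apply/eqP => jx; move: (is_sink_nb (rorient M) a j); rewrite jx (negbTE hx) ha.
Qed.

Lemma iso_onto M N : iso M N -> onto_sinks M -> onto_sinks N.
Proof.
move=> [oE [f [g [hf hg fg]]]] oM x hx; rewrite oE in hx.
apply/mxcol_fullP => m w w0; have [_ gf] := fg x.
rewrite -[w]mul1mx -gf -mulmxA; suff -> : f x *m w = 0 by rewrite mulmx0.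
apply: (proj1 (mxcol_fullP (fun j => rmap M (nb x j) x)) (oM x hx)) => j; rewrite mulmxA -hf.
  by rewrite -mulmxA w0 mulmx0.
by rewrite /arrow hx adj_sym andbT; apply/existsP; exists j.
Qed.

Lemma iso_into M N : iso M N -> into_sources M -> into_sources N.
Proof.
move=> [oE [f [g [hf hg fg]]]] iM x hx; rewrite oE in hx.
apply/mxrow_freeP => m w w0; have [_ gf] := fg x.
rewrite -[w]mulmx1 -gf mulmxA; suff -> : w *m g x = 0 by rewrite mul0mx.
apply: (proj1 (mxrow_freeP (fun j => rmap M x (nb x j))) (iM x hx)) => j; rewrite -mulmxA hg.
  by rewrite mulmxA w0 mul0mx.
by rewrite /arrow oE is_sink_nb hx andbT; apply/existsP; exists j.
Qed.

Lemma ses_onto M N : ses M N -> onto_sinks M.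
Proof.
move=> [g [h s]] x hx; apply/mxcol_fullP => m w w0.
exact: (se_epi (ses_exact s hx)).
Qed.

Lemma ses_into M N : ses M N -> into_sources N.
Proof.
move=> [g [h s]] x; rewrite (ses_orient s) is_sinkN negbK => hx.
apply/mxrow_freeP => m w w0; apply: (se_mono (ses_exact s hx)) => j.
by rewrite mulmxA w0 mul0mx.
Qed.

Lemma ses_dim_source M N a : ses M N -> ~~ is_sink (rorient M) a -> rdim N a = rdim M a.
Proof.
move=> [g [h s]] ha; have /mulmx1_min := ses_idl s ha.
have /mulmx1_min := ses_idr s ha; lia.
Qed.

Lemma ses_dim_sink M N x : ses M N -> is_sink (rorient M) x ->
  (rdim N x + rdim M x)%N = (\sum_(j < n) rdim M (nb x j))%N.
Proof. by move=> [g [h s]] hx; rewrite (se_dim (ses_exact s hx)). Qed.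

(** By symmetry of adjacency, [P] is constant along edges inside the support, so its truth value,
    taken as a scalar at each vertex, is an idempotent endomorphism. *)
Lemma indec_closed M (P : pred (vert n)) : indec M ->
  (forall a b, adj a b -> rdim M a != 0%N -> rdim M b != 0%N -> P a -> P b) ->
  forall a b, rdim M a != 0%N -> rdim M b != 0%N -> P a -> P b.
Proof.
move=> iM cP.
have PE a b : adj a b -> rdim M a != 0%N -> rdim M b != 0%N -> P a = P b.
  move=> ab ha hb; apply/idP/idP; first exact: (cP a b).
  by apply: (cP b a) => //; rewrite adj_sym.
pose e : mxfamily M M := fun a => (P a)%:R%:M.
have he : hom e.
  move=> a b /andP [ab _]; rewrite /e.
  have [a0|na] := eqVneq (rdim M a) 0%N.
    by apply/matrixP => -[i hi]; exfalso; rewrite a0 in hi.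
  have [b0|nb] := eqVneq (rdim M b) 0%N.
    by apply/matrixP => i [j hj]; exfalso; rewrite b0 in hj.
  by rewrite (PE a b) // mul_scalar_mx mul_mx_scalar.
have ee a : e a *m e a = e a.
  by rewrite /e -scalar_mxM -natrM mulnb andbb.
move=> a b ha hb Pa; case: (iM e he ee) => E.
- case/eqP: ha; apply: (@mx_dim0 k); rewrite -(E a) /e Pa; by [].
- apply: contraT => Pb; case/eqP: hb; apply: (@mx_dim0 k).
  by rewrite -(E b) /e (negbTE Pb) -scalemx1 scale0r.
Qed.

Lemma shift_intS M (m : nat) : shift_int M (Posz m + 1) = sigma (shift_int M (Posz m)).
Proof. by rewrite -PoszD addn1. Qed.

Lemma shift_intP M (m : nat) :
  shift_int M (- Posz m - 1) = sigmam (shift_int M (- Posz m)).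
Proof.
have -> : - Posz m - 1 = Negz m by lia.
by case: m => [|m] //; rewrite -NegzE.
Qed.

Section Regular.
Variable M : rep k n.
Hypothesis rM : regular M.
Let X t := shift_int M t.

Let indec0 : indec M.
Proof. by apply: indecomposable_indec; case: rM. Qed.

(** The two claims need each other: indecomposability yields the next sequence, and the sequence
    carries indecomposability to the next module. *)
Let up (m : nat) : indec (X (Posz m)) /\ ses (X (Posz m)) (X (Posz m + 1)).
Proof.
elim: m => [|m [iX sX]].
  split=> //; rewrite /X shift_intS; apply: ses_sigma; apply: sigma_onto => //.
  exact: (proj2 rM 1).
have iX' : indec (X (Posz m.+1)).
  by have := ses_indec_r sX iX; rewrite -PoszD addn1.
split=> //; rewrite /X shift_intS; apply: ses_sigma; apply: sigma_onto => //.
rewrite -shift_intS; exact: (proj2 rM _).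
Qed.

Let down (m : nat) : indec (X (- Posz m)) /\ ses (X (- Posz m - 1)) (X (- Posz m)).
Proof.
elim: m => [|m [iX sX]].
  split=> //; rewrite /X shift_intP; apply: ses_sigmam; apply: sigmam_into => //.
  exact: (proj2 rM (-1)).
have iX' : indec (X (- Posz m.+1)).
  have -> : - Posz m.+1 = - Posz m - 1 by lia.
  exact: ses_indec_l sX iX.
split=> //; rewrite /X shift_intP; apply: ses_sigmam; apply: sigmam_into => //.
rewrite -shift_intP; exact: (proj2 rM _).
Qed.

Lemma indec_shift t : indec (shift_int M t).
Proof.
case: t => m; first by case: (up m).
by rewrite NegzE; case: (down m.+1).
Qed.

Lemma ses_shift t : ses (shift_int M t) (shift_int M (t + 1)).
Proof.
case: t => m; first by case: (up m).
have [_] := down m; rewrite NegzE.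
have -> : - Posz m.+1 = - Posz m - 1 by lia.
by rewrite subrK.
Qed.

(** [sigma] and [sigmam] are mutually inverse on the orbit only up to isomorphism. The induction
    compares two sequences with isomorphic terms at one end. *)
Lemma iso_shift_shift t i : iso (shift_int M (t + i)) (shift_int (shift_int M t) i).
Proof.
case: i => m.
- elim: m => [|m IH]; first by rewrite addr0; exact: iso_refl.
  rewrite -addn1 PoszD shift_intS addrA.
  have oX := iso_onto IH (ses_onto (ses_shift _)).
  exact: ses_iso_r (ses_shift _) (ses_sigma oX) IH.
- rewrite NegzE; elim: m.+1 => [|{}m IH]; first by rewrite oppr0 addr0; exact: iso_refl.
  have -> : - Posz m.+1 = - Posz m - 1 by lia.
  have s : ses (shift_int M (t + (- Posz m - 1))) (shift_int M (t + - Posz m)).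
    have := ses_shift (t + (- Posz m - 1)); by rewrite addrA subrK.
  rewrite shift_intP.
  exact: ses_iso_l s (ses_sigmam (iso_into IH (ses_into s))) IH.
Qed.

End Regular.
End Orbit.

(** * The tree as a Cayley graph: words relative to a base vertex *)

Section Words.
Variable n : nat.
Implicit Types (c v : vert n) (s r w : seq 'I_n) (i j : 'I_n).

Lemma reduced_cons i s : reduced (i :: s) -> reduced s.
Proof. by rewrite /reduced /=; exact: path_sorted. Qed.

(** As in the words underlying [vert], the head is the last step: [s ++ r] follows [r] first, and
    prepending a letter moves one edge onwards. *)
Definition walk c s : vert n := foldr (fun i v => nb v i) c s.

Lemma walk_cat c s r : walk c (s ++ r) = walk (walk c r) s.
Proof. exact: foldr_cat. Qed.

Lemma walk_rcons c s i : walk c (rcons s i) = walk (nb c i) s.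
Proof. by rewrite -cats1 walk_cat. Qed.

Lemma walk_revK c s : walk (walk c (rev s)) s = c.
Proof.
elim: s c => //= i s IH c.
by rewrite rev_cons walk_rcons IH nb_involutive.
Qed.

Lemma nb_rawP s j : reduced s -> s = j :: nb_raw s j \/ nb_raw s j = j :: s.
Proof. by case: s => [|i s] /= _; [right|case: eqP => [->|_]; [left|right]]. Qed.

Lemma nb_cons i s (h : reduced (i :: s)) (h' : reduced s) :
  nb (exist _ s h' : vert n) i = exist _ (i :: s) h.
Proof.
apply: val_inj => /=; case: s h h' => //= j s; rewrite /reduced /= => /andP [ij _] _.
by rewrite eq_sym (negbTE ij).
Qed.

Lemma val_walk_root s : reduced s -> val (walk (troot n) s) = s.
Proof.
elim: s => //= i s IH h; rewrite (IH (reduced_cons h)).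
have := congr1 val (nb_cons h (reduced_cons h)); by [].
Qed.

Lemma walk_root v : walk (troot n) (val v) = v.
Proof. by apply: val_inj; rewrite val_walk_root // (valP v). Qed.

Lemma walk_nb_raw c s i : reduced s -> walk c (nb_raw s i) = nb (walk c s) i.
Proof.
case/(@nb_rawP s i) => [E|-> //]; rewrite {2}E /= nb_involutive; by [].
Qed.

Lemma walk_nb c v i : walk c (val (nb v i)) = nb (walk c (val v)) i.
Proof. exact: walk_nb_raw (valP v). Qed.

Lemma walk_mul c v s : walk c (val (walk v s)) = walk (walk c (val v)) s.
Proof. by elim: s => //= i s <-; rewrite walk_nb. Qed.

(* The vertices form a group acting on the tree by left translations;
   [coord c v] is the product of the inverse of [c] with [v], so its word
   describes the path from [c] to [v]. *)
Definition coord c v : seq 'I_n := val (walk (walk (troot n) (rev (val c))) (val v)).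

Lemma coord_reduced c v : reduced (coord c v).
Proof. exact: valP. Qed.

Lemma walk_coord c v : walk c (coord c v) = v.
Proof.
rewrite /coord walk_mul walk_mul /=.
suff -> : walk c (rev (val c)) = troot n by rewrite walk_root.
by rewrite -{1}[c]walk_root -{1}(revK (val c)) walk_revK.
Qed.

Lemma coord_walk c s : reduced s -> coord c (walk c s) = s.
Proof.
move=> h; rewrite /coord walk_mul walk_revK; exact: val_walk_root.
Qed.

Lemma walk_inj c s r : reduced s -> reduced r -> walk c s = walk c r -> s = r.
Proof. by move=> hs hr E; rewrite -(coord_walk c hs) E coord_walk. Qed.

Lemma coord_nb c v i : coord c (nb v i) = nb_raw (coord c v) i.
Proof. by rewrite /coord walk_nb. Qed.

Lemma coord_adj c v v' : adj v v' ->
  exists j, coord c v = j :: coord c v' \/ coord c v' = j :: coord c v.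
Proof.
move=> /existsP [j /eqP <-]; exists j; rewrite coord_nb.
by apply: nb_rawP; exact: coord_reduced.
Qed.

(* The first letter of the path described by a word, i.e. the branch at the origin. *)
Definition branch s : option 'I_n := if s is i :: r then Some (last i r) else None.

Lemma branch_cons i s : s != [::] -> branch (i :: s) = branch s.
Proof. by case: s. Qed.

Lemma branch_cat s r : r != [::] -> branch (s ++ r) = branch r.
Proof.
move=> hr; elim: s => // i s IH; rewrite cat_cons branch_cons //.
by case: s {IH}.
Qed.

Lemma branch_rcons s i : branch (rcons s i) = Some i.
Proof. by case: s => //= j s; rewrite last_rcons. Qed.

Lemma reduced_rcons s i : reduced (rcons s i) = reduced s && (branch s != Some i).
Proof. by case: s => //= j s; rewrite /reduced /= rcons_path. Qed.

(** Change of base vertex from [nb c j] to [c]. If the path starts by crossing to [c], its first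
    letter [j] is cancelled; otherwise a [j] is put in front of the path, which is the tail of the
    word. *)
Lemma walk_turn c j s : reduced s -> exists r, [/\ reduced r, walk c r = walk (nb c j) s
  & (s = rcons r j /\ branch r != Some j) \/ (r = rcons s j /\ branch s != Some j)].
Proof.
move=> hs; case: (boolP (branch s == Some j)) => h; last first.
  exists (rcons s j); rewrite reduced_rcons hs h walk_rcons; split=> //; by right.
case/lastP: s hs h => // r i; rewrite branch_rcons reduced_rcons.
case/andP => hr hb /eqP [E]; rewrite {}E in hb *.
exists r; rewrite walk_rcons nb_involutive; split=> //; by left.
Qed.

Hypothesis hn : (2 < n)%N.

Lemma two_letters i : exists x y : 'I_n, [/\ x != y, x != i & y != i].
Proof.
pose o0 : 'I_n := Ordinal (ltnW (ltnW hn)); pose o1 : 'I_n := Ordinal (ltnW hn).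
pose o2 : 'I_n := Ordinal hn.
have [E0|h0] := eqVneq i o0; first by exists o1, o2; rewrite E0.
have [E1|h1] := eqVneq i o1; first by exists o0, o2; rewrite E1.
by exists o0, o1; rewrite !(eq_sym _ i).
Qed.

Lemma reduced_extend m s : s != [::] -> reduced s ->
  exists r, size r = m /\ reduced (r ++ s).
Proof.
move=> hs rs; elim: m => [|m [r [rm hr]]]; first by exists [::].
case E: (r ++ s) => [|i q]; first by move: hs; case: (s) r E {hr rm} => // ? ? [].
have [x [_ [_ xi _]]] := two_letters i.
by exists (x :: r); rewrite /= rm E /reduced /= xi; rewrite E in hr.
Qed.

Lemma reduced_grow s : reduced s -> exists x, reduced (x :: s).
Proof.
case: s => [|y s] hs; first by exists (Ordinal hn).
by have [x [_ [_ xy _]]] := two_letters y; exists x; rewrite /reduced /= xy.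
Qed.

End Words.

Lemma leq_odd m p : (m <= p.+1)%N -> odd m != odd p.+1 -> (m <= p)%N.
Proof. by rewrite leq_eqVlt => /orP [/eqP ->|//]; rewrite eqxx. Qed.

(** * Supports as vertex sets with a center, and one shift step *)

Section States.
Variable n : nat.
Hypothesis hn : (2 < n)%N.
Implicit Types (c v : vert n) (s r w : seq 'I_n) (i j : 'I_n) (S : pred (vert n)).

(* [S] is a vertex set of diameter [2 R] with center [c]. *)
Definition even_state S c R : Prop :=
  (forall s, reduced s -> S (walk c s) -> (size s <= R)%N) /\
  exists s r, [/\ reduced s, reduced r, S (walk c s) & S (walk c r)] /\
    [/\ size s = R, size r = R & (R == 0%N) || (branch s != branch r)].

(* [S] is a vertex set of diameter [2 R + 1] with center the edge [{c, nb c i}]. *)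
Definition flow_state S c i R : Prop :=
  [/\ forall s, reduced s -> S (walk c s) -> (size s <= R + (branch s == Some i))%N,
      exists s, [/\ reduced s, S (walk c s), branch s = Some i & size s = R.+1] &
      exists s, [/\ reduced s, S (walk c s), branch s != Some i & size s = R]].

(** The definition singles out one end of the central edge; this restores the symmetry between the
    two ends. *)
Lemma flow_turn S c i R : flow_state S c i R -> flow_state S (nb c i) i R.
Proof.
move=> [ball [s [hs Ss bs zs]] [r [hr Sr br zr]]]; split.
- move=> u hu Su; have [w [hw E]] := walk_turn c i hu.
  rewrite -E in Su; have := ball w hw Su.
  case=> [] zw [[Eu bw]|[Eu bu]]; move: zw; rewrite Eu ?branch_rcons ?eqxx size_rcons.
    by rewrite (negbTE bw) addn0 addn1 ltnS.
  by rewrite (negbTE bu) addn0 addn1 ltnS.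
- exists (rcons r i); rewrite reduced_rcons hr br branch_rcons size_rcons zr.
  by rewrite walk_rcons nb_involutive.
- case/lastP: s hs Ss bs zs => // s j; rewrite reduced_rcons branch_rcons size_rcons.
  by move=> /andP [hs bs] Ss [E] [zs]; rewrite {}E in bs Ss; exists s; rewrite -walk_rcons.
Qed.

(* Invariant of a run of flow modules after [m] steps, with current source side
   [c] and center [{c, nb c i}]: a fixed end [z = walk c w] of the initial flow
   module lies at distance [R - m] from [c], and everything at distance [m]
   beyond [z] is in [S].  At [m = R] the center has reached [z], and since
   [n >= 3] the set branches there, so the run stops. *)
Definition spread S c i R m : Prop :=
  exists w, [/\ (size w + m = R)%N, reduced (rcons w i) &
    forall s, size s = m -> reduced (rcons (s ++ w) i) -> S (walk c (s ++ w))].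

Lemma spread0 S c i R : flow_state S c i R -> spread S c i R 0.
Proof.
move=> [_ _ [w [hw Sw bw zw]]]; exists w; rewrite addn0 reduced_rcons hw bw.
by split=> // -[].
Qed.

Definition step S S' (snk : pred (vert n)) : Prop := forall v,
  (~~ snk v -> S' v = S v) /\ (snk v -> (S v || S' v) = [exists j, S (nb v j)]).

Definition alternating (snk : pred (vert n)) := forall v i, snk (nb v i) = ~~ snk v.

Lemma alternating_walk snk c s : alternating snk -> snk (walk c s) = snk c (+) odd (size s).
Proof.
by move=> H; elim: s => [|i s IH] /=; rewrite ?addbF // H IH -addbN.
Qed.

Lemma step_sym S S' snk : alternating snk -> step S S' snk -> step S' S snk.
Proof.
move=> alt st v; split=> hv; first by rewrite (proj1 (st v)).
rewrite orbC (proj2 (st v)) //; apply: eq_existsb => j.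
by rewrite (proj1 (st _)) // alt hv.
Qed.

Section Step.
Variables (S S' : pred (vert n)) (snk : pred (vert n)).
Hypothesis alt : alternating snk.
Hypothesis st : step S S' snk.

Lemma step_nb c s : reduced s -> snk (walk c s) -> S (walk c s) || S' (walk c s) ->
  exists r j, [/\ reduced r, S (walk c r) & s = j :: r \/ r = j :: s].
Proof.
move=> hs hk; rewrite (proj2 (st _)) // => /existsP [j Sj].
exists (nb_raw s j), j; rewrite nb_raw_reduced // walk_nb_raw //; split=> //.
exact: nb_rawP.
Qed.

Lemma step_child c s i : snk c (+) odd (size s) = false ->
  S (walk c s) -> ~~ S (walk c (i :: s)) -> S' (walk c (i :: s)).
Proof.
move=> hk Ss nS; have : S (walk c (i :: s)) || S' (walk c (i :: s)).
  rewrite (proj2 (st _)); last by rewrite alternating_walk //= addbN hk.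
  by apply/existsP; exists i; rewrite /= nb_involutive.
by rewrite (negbTE nS).
Qed.

(** A sink of [S] has a neighbour in [S]. If no child qualifies, it is the parent, and this source
    stays in [S']. *)
Lemma step_parent c s i : reduced (i :: s) -> snk c (+) odd (size s) = false ->
  S (walk c (i :: s)) -> (forall j, reduced (j :: i :: s) -> ~~ S (walk c (j :: i :: s))) ->
  S (walk c s) /\ S' (walk c s).
Proof.
move=> hs hk Ss nS; have [||r [j [hr Sr [[_ E]|E]]]] := @step_nb c _ hs.
- by rewrite alternating_walk //= addbN hk.
- by rewrite Ss.
- by rewrite E (proj1 (st _)) // alternating_walk // -E hk.
- by rewrite E in hr Sr; have := nS j hr; rewrite Sr.
Qed.

(** The parity condition makes the vertices at distance [R] sources. Their outward neighbours are
    sinks outside [S], so they enter [S'], in the same branches. *)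
Lemma step_source c R : snk c = odd R -> even_state S c R -> even_state S' c R.+1.
Proof.
move=> hk [ball [s [r [[hs hr Ss Sr] [zs zr sr]]]]]; split.
- move=> u hu Su; case hku: (snk (walk c u)).
    have [|w [j [hw Sw E]]] := step_nb hu hku; first by rewrite Su orbT.
    by have := ball w hw Sw; case: E => -> /=; clear; lia.
  rewrite (proj1 (st _)) ?hku // in Su; exact: leqW (ball u hu Su).
- have ext u x : reduced u -> S (walk c u) -> size u = R -> reduced (x :: u) ->
      S' (walk c (x :: u)) /\ size (x :: u) = R.+1.
    move=> hu Su zu hxu; split; last by rewrite /= zu.
    apply: step_child => //; first by rewrite hk zu addbb.
    by apply/negP => /(ball _ hxu) /=; rewrite zu ltnn.
  (* For [R = 0] the set is the single source [c], and the two branches have to come from two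
     distinct letters at [c]. *)
  case: (posnP R) sr => [R0 _|Rpos /= sr].
    have [x [y [xy _ _]]] := two_letters hn (Ordinal (ltnW (ltnW hn))).
    have s0 : s = [::] by apply/nilP; rewrite /nilp zs R0.
    rewrite s0 in hs Ss zs.
    have [Sx zx] := ext [::] x hs Ss zs isT; have [Sy zy] := ext [::] y hs Ss zs isT.
    exists [:: x], [:: y]; split; split; rewrite //= ?R0 //.
  have nz u : size u = R -> u != [::] by case: u => // zu; rewrite -zu in Rpos.
  have [x hx] := reduced_grow hn hs; have [y hy] := reduced_grow hn hr.
  have [Sx zx] := ext s x hs Ss zs hx; have [Sy zy] := ext r y hr Sr zr hy.
  exists (x :: s), (y :: r); rewrite !branch_cons ?nz //; split; split=> //.
Qed.

Lemma ball_cases c R s : 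
  (forall u, reduced u -> S' (walk c u) -> (size u <= R.+1)%N) ->
  reduced s -> S' (walk c s) -> size s = R.+1 ->
  even_state S' c R.+1 \/ exists j, branch s = Some j /\
    forall u, reduced u -> S' (walk c u) -> size u = R.+1 -> branch u = Some j.
Proof.
move=> ball hs Ss zs; case: (classic (even_state S' c R.+1)) => [|ne]; first by left.
right; case: s zs hs Ss => // i s zs hs Ss; exists (last i s); split=> // u hu Su zu.
apply/eqP/negPn/negP => bu; case: ne; split=> //.
by exists u, (i :: s); rewrite bu orbT.
Qed.

(** Growth takes place at distance [R + 1] from the source side [c]. If the extreme vertices of [S']
    occupy two branches, the run ends in a source state; if they share one branch [j], the center
    moves to the edge towards [nb c j]. *)
Lemma step_flow c i R m : snk c = odd R -> flow_state S c i R -> spread S c i R m ->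
  even_state S' c R.+1 \/
  exists j, [/\ j != i, (m < R)%N, flow_state S' (nb c j) j R & spread S' (nb c j) j R m.+1].
Proof.
move=> hk [ball [p [hp Sp bp zp]] _] [w [zw hw Sw]].
(* A new sink is next to a vertex at distance at most [R + 1]; distance [R + 2] has the parity of
   sources. *)
have ball' u : reduced u -> S' (walk c u) -> (size u <= R.+1)%N.
  move=> hu Su; case hku: (snk (walk c u)); last first.
    rewrite (proj1 (st _)) ?hku // in Su; have := ball u hu Su; case: (_ == _); clear; lia.
  have [|r [j [hr Sr E]]] := step_nb hu hku; first by rewrite Su orbT.
  rewrite alternating_walk // hk in hku.
  apply: leq_odd; last by move: hku => /=; rewrite negbK; case: (odd _); case: (odd _).
  have := ball r hr Sr; case: E => -> /=; case: (_ == _) => /=; clear; lia.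
(* The parent of [x ++ w] lies in [S] by [spread]; at distance [R] off branch [i] it is an outermost
   source there, so all its children enter [S']. *)
have Sx x : size x = m.+1 -> reduced (rcons (x ++ w) i) ->
    [/\ reduced (x ++ w), S' (walk c (x ++ w)), size (x ++ w) = R.+1 & branch (x ++ w) != Some i].
  case: x => // l x [zx]; rewrite reduced_rcons => /andP [hx bx].
  have zlx : size ((l :: x) ++ w) = R.+1 by rewrite /= size_cat zx -zw addnC.
  split=> //; apply: step_child.
  - by rewrite hk size_cat zx addnC zw addbb.
  - apply: Sw => //; rewrite reduced_rcons (reduced_cons hx) /=.
    by case E: (x ++ w) bx => [|y q] //; rewrite cat_cons E branch_cons.
  - apply/negP => /(ball _ hx); rewrite zlx /= -/(branch (_ :: _)).
    by move: bx; rewrite cat_cons => /negbTE ->; rewrite addn0 ltnn.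
have [x0 [zx0 hx0]] : exists x, size x = m.+1 /\ reduced (rcons (x ++ w) i).
  have [x [zx hx]] := reduced_extend hn m.+1 (s := rcons w i) (ltac:(by case: (w))) hw.
  by exists x; rewrite zx rcons_cat.
have [hx Sx0 zxw bx] := Sx x0 zx0 hx0.
case: (ball_cases ball' hx Sx0 zxw) => [|[j [bj allj]]]; [by left|right].
have ji : j != i by apply: contra bx => /eqP <-; rewrite bj.
have zp' : (0 < size p)%N by rewrite zp.
(* If the center had already reached the fixed end, [Sx] would give extreme vertices in every branch
   other than [i]; there are at least two of these, against [allj]. *)
have wnz : w != [::].
  apply/eqP => w0; rewrite w0 /= in zw.
  have [x [y [xy xi yi]]] := two_letters hn i.
  have S1 z : z != i -> branch x0 = Some z.
    move=> zi; have [q [zq hq]] := reduced_extend hn m (s := [:: z; i]) isT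
      (ltac:(by rewrite /reduced /= zi)).
    have [||h1 h2 h3 h4] := Sx (rcons q z).
    + by rewrite size_rcons zq.
    + by rewrite w0 cats0 -!cats1 -catA.
    + have := allj _ h1 h2 h3; rewrite w0 cats0 branch_rcons => -[->].
      by move: bj; rewrite w0 cats0.
  by move: xy; have := S1 x xi; rewrite (S1 y yi) => -[->]; rewrite eqxx.
case/lastP: w wnz zw hw Sw hx0 hx Sx0 zxw bx bj Sx => // w l _ zw hw Sw hx0 hx Sx0 zxw bx bj Sx.
have lj : l = j by move: bj; rewrite branch_cat -?size_eq0 ?size_rcons // branch_rcons => -[].
rewrite {}lj in zw hw Sw hx0 hx Sx0 zxw bx bj Sx; rewrite size_rcons in zw.
exists j; split=> //; first by rewrite -zw; clear; lia.
(* The flow state is checked from [c]; turning it makes [nb c j] the base, the source side for the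
   reversed orientation. *)
- apply: flow_turn; split.
  + move=> u hu Su; have := ball' u hu Su; rewrite leq_eqVlt => /orP [/eqP zu|].
      by rewrite (allj u) // eqxx addn1 zu.
    by rewrite ltnS => h; apply: leq_trans h (leq_addr _ _).
  + by exists (x0 ++ rcons w j).
  (* The old extreme sink [p] in branch [i] may disappear, but its parent is a source at distance
     [R] and survives. *)
  + case: p hp Sp bp zp zp' => // y p hp Sp bp [zp] _.
    have [||Sp1 Sp2] := step_parent hp _ Sp.
    * by rewrite hk zp addbb.
    * move=> q hq; apply/negP => /(ball _ hq); rewrite /= zp; case: (_ == _); clear; lia.
    exists p; rewrite (reduced_cons hp) zp; split=> //.
    by case: p bp {hp Sp zp Sp1 Sp2} => // a p; rewrite branch_cons // => -> ; apply/eqP => -[E];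
       rewrite E eqxx in ji.
(* This [w] is the former word without its first step [j]: the fixed end is one edge closer, and the
   spread beyond it one edge deeper. *)
- exists w; split; first by rewrite -zw; clear; lia.
    by move: hw; rewrite reduced_rcons => /andP [].
  move=> s zs hs; rewrite -walk_rcons rcons_cat.
  have [] // := Sx s zs.
  by rewrite -rcons_cat reduced_rcons hs branch_rcons; apply/eqP => -[E]; rewrite E eqxx in ji.
Qed.

(** By parity [S'] stays within distance [R], and it keeps the parents of the extreme sinks. The
    three outcomes correspond to its vertices at distance [R] meeting no branch, several, or exactly
    one. *)
Lemma step_sink c R : snk c = ~~ odd R -> even_state S c R ->
  exists R', R = R'.+1 /\
    (even_state S' c R' \/ even_state S' c R \/ exists i, flow_state S' c i R').
Proof.
move=> hk [ball [s [r [[hs hr Ss Sr] [zs zr sr]]]]].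
(* For [R = 0] the set would be a lone sink, with no neighbour in [S] to support it. This is why a
   sink module has positive radius. *)
have par u : reduced u -> S (walk c u) -> size u = R -> exists x q, [/\ u = x :: q,
    reduced q, S' (walk c q) & size u = (size q).+1].
  case: u => [|x q] hu Su zu.
    have [||q [j [hq Sq [//|E]]]] := @step_nb c _ hu.
    + by rewrite alternating_walk // hk -zu.
    + by rewrite Su.
    + by have := ball q hq Sq; rewrite E -zu.
  have [||Sq1 Sq2] := step_parent hu _ Su.
  + by rewrite hk -zu /= negbK addbb.
  + by move=> j hj; apply/negP => /(ball _ hj); rewrite -zu /=; clear; lia.
  by exists x, q; rewrite (reduced_cons hu).
have ball' u : reduced u -> S' (walk c u) -> (size u <= R)%N.
  move=> hu Su; case hku: (snk (walk c u)); last first.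
    rewrite (proj1 (st _)) ?hku // in Su; exact: ball.
  have [|q [j [hq Sq E]]] := step_nb hu hku; first by rewrite Su orbT.
  rewrite alternating_walk // hk in hku.
  apply: leq_odd; last by move: hku => /=; case: (odd _); case: (odd _).
  by have := ball q hq Sq; case: E => -> /=; clear; lia.
have [x [s' [Es hs' Ss' zs']]] := par s hs Ss zs.
have [y [r' [Er hr' Sr' zr']]] := par r hr Sr zr.
case: R => [|R] in hk ball zs zr sr par ball' *; first by rewrite zs' in zs.
exists R; split=> //.
have {}zs' : size s' = R by move: zs'; rewrite zs => -[].
have {}zr' : size r' = R by move: zr'; rewrite zr => -[].
have sr' : (R == 0%N) || (branch s' != branch r').
  move: sr; rewrite Es Er /=; case: s' r' {Es Er hs' hr' Ss' Sr'} zs' zr' => [|a s'] [|b r'] //=; 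
  by move=> <-.
case: (classic (exists u, [/\ reduced u, S' (walk c u) & size u = R.+1])) => [[u [hu Su zu]]|no].
- case: (ball_cases ball' hu Su zu) => [|[j [bj allj]]]; first by right; left.
  right; right; exists j; split.
  + move=> q hq Sq; have := ball' q hq Sq; rewrite leq_eqVlt => /orP [/eqP zq|].
      by rewrite (allj q) // eqxx addn1 zq.
    by rewrite ltnS => h; apply: leq_trans h (leq_addr _ _).
  + by exists u.
  + case: (boolP (branch s' == Some j)) => h; last by exists s'.
    exists r'; split=> //; case/orP: sr' => [/eqP R0|].
      by move: zr'; rewrite R0; case: (r').
    by rewrite (eqP h) eq_sym.
- left; split; last by exists s', r'.
  move=> u hu Su; have := ball' u hu Su; rewrite leq_eqVlt => /orP [/eqP zu|//].
  by case: no; exists u.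
Qed.

End Step.

(** Take a ball of smallest radius containing [S]. Extreme vertices in two branches make its center
    the center of [S]; otherwise the center is an edge. *)
Lemma state_exists S (l : seq (vert n)) : (forall v, S v -> v \in l) -> (exists v, S v) ->
  exists c R, even_state S c R \/ exists i, flow_state S c i R.
Proof.
move=> Sl [v0 Sv0].
pose B R := exists c, forall s, reduced s -> S (walk c s) -> (size s <= R)%N.
have [R [[c ball] min]] : exists R, B R /\ forall R', (R' < R)%N -> ~ B R'.
  have [R0 hR0] : exists R0, forall v, v \in l -> (size (val v) <= R0)%N.
    elim: (l) => [|v l' [R0 hR0]]; first by exists 0%N.
    exists (maxn (size (val v)) R0) => u; rewrite inE => /orP [/eqP ->|/hR0 h].
      exact: leq_maxl.
    by rewrite leq_max h orbT.
  have BR : B R0 by exists (troot n) => s hs /Sl /hR0; rewrite val_walk_root.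
  elim: R0 {-2}R0 (leqnn R0) BR {hR0} => [|R IH] Q leQ BQ.
    by exists Q; split=> // R'; move: leQ; clear; lia.
  case: (classic (exists R', (R' < Q)%N /\ B R')) => [[R' [lt BR']]|no].
    by apply: IH BR'; move: leQ lt; clear; lia.
  by exists Q; split=> // R' lt BR'; apply: no; exists R'.
exists c.
case: R => [|R] in ball min *.
  exists 0%N; left; split=> //; exists [::], [::].
  have h := ball _ (coord_reduced c v0); rewrite walk_coord in h.
  have := walk_coord c v0; case: (coord c v0) (h Sv0) => //= _ E.
  by rewrite /= E.
case: (classic (exists u, [/\ reduced u, S (walk c u) & size u = R.+1])) => [[u [hu Su zu]]|no];
  last first.
  case: (min R) => //; exists c => s hs Ss; have := ball s hs Ss.
  by rewrite leq_eqVlt => /orP [/eqP zs|//]; case: no; exists s.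
case: (ball_cases ball hu Su zu) => [|[j [bj allj]]]; first by exists R.+1; left.
exists R; right; exists j; split.
- move=> q hq Sq; have := ball q hq Sq; rewrite leq_eqVlt => /orP [/eqP zq|].
    by rewrite (allj q) // eqxx addn1 zq.
  by rewrite ltnS => h; apply: leq_trans h (leq_addr _ _).
- by exists u.
(* With no vertex at distance [R] off branch [j], moving the center along [j] would give a smaller
   ball. *)
- apply: NNPP => no; apply: (min R) => //; exists (nb c j) => s hs Ss.
  have [q [hq E H]] := walk_turn c j hs; rewrite -E in Ss.
  have := ball q hq Ss; case: H => [[-> bq]|[-> bs]]; last by rewrite size_rcons ltnS.
  rewrite size_rcons leq_eqVlt => /orP [/eqP zq|].
    by rewrite (allj q) ?eqxx // in bq.
  rewrite ltnS leq_eqVlt => /orP [/eqP zq|//].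
  by case: no; exists q.
Qed.
End States.

(** * Following a whole orbit *)

Section Sequences.
Variable n : nat.
Hypothesis hn : (2 < n)%N.
Implicit Types (c v : vert n) (i j : 'I_n) (a : seq (vert n)).

Lemma is_path_cons v a : is_path a -> adj v (nth (troot n) a 0) ->
  ((1 < size a)%N -> v != nth (troot n) a 1) -> is_path (v :: a).
Proof.
move=> [_ adja nba] va va1; split=> //.
- by case=> [|i] //=; exact: adja.
- by case=> [|i] //=; exact: nba.
Qed.

Lemma adj_nb c i : adj (nb c i) c.
Proof. by rewrite adj_sym; apply/existsP; exists i. Qed.

Record shift_seq (S snk : int -> pred (vert n)) : Prop := ShiftSeq {
  ss_alt : forall t, alternating (snk t);
  ss_flip : forall t v, snk (t + 1) v = ~~ snk t v;
  ss_step : forall t, step (S t) (S (t + 1)) (snk t) }.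

(* The axioms of [shift_seq] are invariant under reversing time, which
   exchanges sinks and sources. *)
Lemma shift_seq_rev S snk : shift_seq S snk ->
  shift_seq (fun t => S (- t)) (fun t => snk (- t - 1)).
Proof.
move=> [alt flip st]; split=> [t|t v|t]; first exact: alt.
- have := flip (- (t + 1) - 1) v; rewrite opprD subrK => ->; by rewrite negbK.
- rewrite opprD; have := step_sym (alt _) (st (- t - 1)); by rewrite subrK.
Qed.

Section Forward.
Variables S snk : int -> pred (vert n).
Hypothesis ss : shift_seq S snk.

Lemma snk_add t (i : nat) v : snk (t + Posz i) v = snk t v (+) odd i.
Proof.
elim: i => [|i IH]; first by rewrite addr0 addbF.
by rewrite -addn1 PoszD addrA (ss_flip ss) IH addn1 /= addbN.
Qed.

(** Radius and orientation change together, so the parity condition persists. *)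
Lemma source_forward t c R (i : nat) : snk t c = odd R -> even_state (S t) c R ->
  even_state (S (t + Posz i)) c (R + i).
Proof.
move=> hk E; elim: i => [|i IH]; first by rewrite addr0 addn0.
rewrite -addn1 PoszD addrA addn1 addnS.
apply: (step_source hn (ss_alt ss _) (ss_step ss _)) IH.
by rewrite snk_add hk oddD.
Qed.

(** Induction on [q], the distance still separating [c] from the fixed end in [spread]. The path [a]
    lists the initial sink side followed by the successive source sides. *)
Lemma flow_forward (q m : nat) t c i R : (q + m)%N = R -> snk t c = odd R ->
  flow_state (S t) c i R -> spread (S t) c i R m ->
  exists b a, [/\ size a = b.+1, (0 < b <= q.+1)%N, is_path a,
      nth (troot n) a 0 = nb c i & nth (troot n) a 1 = c] /\
    (forall l, (l < b)%N -> exists j, flow_state (S (t + Posz l)) (nth (troot n) a l.+1) j R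
        /\ nth (troot n) a l = nb (nth (troot n) a l.+1) j) /\
    snk (t + Posz b) (nth (troot n) a b) = odd R.+1 /\
    even_state (S (t + Posz b)) (nth (troot n) a b) R.+1.
Proof.
have base p t' c' i' : snk t' c' = odd R -> flow_state (S t') c' i' R ->
  even_state (S (t' + 1)) c' R.+1 ->
  exists b a, [/\ size a = b.+1, (0 < b <= p.+1)%N, is_path a,
      nth (troot n) a 0 = nb c' i' & nth (troot n) a 1 = c'] /\
    (forall l, (l < b)%N -> exists j, flow_state (S (t' + Posz l)) (nth (troot n) a l.+1) j R
        /\ nth (troot n) a l = nb (nth (troot n) a l.+1) j) /\
    snk (t' + Posz b) (nth (troot n) a b) = odd R.+1 /\
    even_state (S (t' + Posz b)) (nth (troot n) a b) R.+1.
  move=> hk' F' E; exists 1%N, [:: nb c' i'; c']; split; last split; last split.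
  - by split=> //; split=> //; case=> //= _; exact: adj_nb.
  - by case=> // _; exists i'; rewrite addr0.
  - by rewrite (ss_flip ss) hk'.
  - exact: E.
elim: q m t c i => [|q IH] m t c i qm hk F sp;
  case: (step_flow hn (ss_alt ss _) (ss_step ss _) hk F sp) => [E|[j [ji mR F' sp']]];
  try exact: base.
- by move: mR; rewrite -qm ltnn.
- have qm' : (q + m.+1)%N = R by rewrite addnS -addSn.
  have hk' : snk (t + 1) (nb c j) = odd R by rewrite (ss_flip ss) (ss_alt ss) hk negbK.
  have [b [a [[za bq pa a0 a1] [fl [hb E]]]]] := IH _ _ _ _ qm' hk' F' sp'.
  rewrite nb_involutive in a0.
  (* The path for the remaining run starts at [c] and continues to [nb c j]; since [j] differs from
     [i], prepending [nb c i] creates no backtracking. *)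
  exists b.+1, (nb c i :: a); split; [split=> // | split; [|split]] => /=.
  + by rewrite za.
  + by case/andP: bq.
  + apply: is_path_cons => //; first by rewrite a0 adj_nb.
    by rewrite a1 (inj_eq (@nb_inj _ _)) eq_sym.
  + case=> [|l] lb; first by exists i; rewrite a0 addr0.
    have [j' [H1 H2]] := fl l lb; exists j'.
    by rewrite -addn1 addnC PoszD addrA.
  + by rewrite -addn1 addnC PoszD addrA.
  + by rewrite -addn1 addnC PoszD addrA.
Qed.

(** Shrinking lowers the radius, which stays positive, so it stops; the term found is the last sink
    state. *)
Lemma sink_forward R t c : snk t c = ~~ odd R -> even_state (S t) c R ->
  exists (k R' : nat), [/\ snk (t + Posz k) c = ~~ odd R'.+1,
    even_state (S (t + Posz k)) c R'.+1 &
    even_state (S (t + Posz k + 1)) c R'.+1 \/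
    exists i, flow_state (S (t + Posz k + 1)) c i R'].
Proof.
elim: R t => [|R IH] t hk E;
  have [R' [ER H]] := step_sink (ss_alt ss _) (ss_step ss _) hk E => //.
case: ER => ER; rewrite -{}ER in H.
case: H => [E'|H]; last by exists 0%N, R; rewrite addr0.
have [|k [R'' H]] := IH (t + 1) _ E'; first by rewrite (ss_flip ss) hk negbK.
by exists k.+1, R''; rewrite -addn1 addnC PoszD addrA.
Qed.

Lemma flow_source_side t c i R : flow_state (S t) c i R -> snk t c = ~~ odd R ->
  [/\ flow_state (S t) (nb c i) i R, spread (S t) (nb c i) i R 0 & snk t (nb c i) = odd R].
Proof.
move=> F hk; have F' := flow_turn F; split=> //; first exact: spread0.
by rewrite (ss_alt ss) hk negbK.
Qed.

Lemma flow_to_source t c i R : flow_state (S t) c i R ->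
  exists t' c' R', snk t' c' = odd R' /\ even_state (S t') c' R'.
Proof.
wlog hk : c / snk t c = odd R => [H F|F].
  case: (eqVneq (snk t c) (odd R)) => hk; first exact: (H c).
  have [|F' _ hk'] := flow_source_side F; last exact: (H (nb c i)).
  by move: hk; case: (snk _ _); case: (odd R).
have [b [a [_ [_ [H1 H2]]]]] := flow_forward (addn0 R) hk F (spread0 F).
by exists (t + Posz b), (nth (troot n) a b), R.+1.
Qed.

Lemma to_source t c R : even_state (S t) c R \/ (exists i, flow_state (S t) c i R) ->
  exists t' c' R', snk t' c' = odd R' /\ even_state (S t') c' R'.
Proof.
case=> [E|[i F]]; last exact: flow_to_source F.
case: (eqVneq (snk t c) (odd R)) => hk; first by exists t, c, R.
have hk' : snk t c = ~~ odd R by move: hk; case: (snk _ _); case: (odd R).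
have [k [R' [h _ [E'|[i F]]]]] := sink_forward hk' E; last exact: flow_to_source F.
by exists (t + Posz k + 1), c, R'.+1; rewrite (ss_flip ss) h negbK.
Qed.

End Forward.

Lemma shift_seq_orbit S snk (l : seq (vert n)) : shift_seq S snk ->
  (forall v, S 0 v -> v \in l) -> (exists v, S 0 v) ->
  exists (t0 : int) (r0 b : nat) a,
    [/\ (1 <= r0)%N, (b <= r0)%N, size a = b.+1 & is_path a] /\
    [/\ forall i : nat, even_state (S (t0 - Posz i)) (nth (troot n) a 0) (r0 + i),
        snk t0 (nth (troot n) a 0) = ~~ odd r0,
        forall i : nat, (1 <= i <= b)%N -> exists j,
          flow_state (S (t0 + Posz i)) (nth (troot n) a i) j (r0 - 1) /\
          nth (troot n) a i.-1 = nb (nth (troot n) a i) j,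
        forall i : nat, even_state (S (t0 + Posz (b.+1 + i)%N)) (nth (troot n) a b) (r0 + i) &
        snk (t0 + Posz b.+1) (nth (troot n) a b) = odd r0].
Proof.
move=> ss fin0 ne0; have ss' := shift_seq_rev ss.
have [c0 [R0 st0]] := state_exists fin0 ne0.
(* A source state of the reversed sequence is a sink state of the original one. *)
have [t1 [c [R [hk E]]]] : exists t c R, snk t c = ~~ odd R /\ even_state (S t) c R.
  have [] := to_source ss' (t := 0) (c := c0) (R := R0); first by rewrite oppr0.
  move=> t [c [R [h E]]]; exists (- t), c, R; split=> //.
  by rewrite -h -{1}(subrK 1 (- t)) (ss_flip ss).
have [k [r [hk0 E0 next]]] := sink_forward ss hk E.
set t0 := t1 + Posz k in hk0 E0 next; clearbody t0.
(* Backwards in time the last sink state is a source state, which keeps its center and grows. *)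
have back (i : nat) : even_state (S (t0 - Posz i)) c (r.+1 + i).
  have := source_forward ss' (t := - t0) (c := c) (R := r.+1) i.
  rewrite opprD !opprK; apply=> //.
  by have := ss_flip ss (t0 - 1) c; rewrite subrK hk0 => /negb_inj.
exists t0, r.+1; case: next => [Es|[i F]].
(* With no flow term in between, the path is reduced to the common center. *)
- exists 0%N, [:: c]; split; first by split=> //; split=> // -[].
  split=> //=.
  + by case.
  + move=> i; rewrite PoszD addrA; apply: (source_forward ss) => //.
    by rewrite (ss_flip ss) hk0 negbK.
  + by rewrite (ss_flip ss) hk0 negbK.
- have [|F' sp' hk'] := flow_source_side ss F.
    by rewrite (ss_flip ss) hk0 negbK.
  have [b [a [[za /andP [b0 br] pa a0 a1] [fl [hb Eb]]]]] :=
    flow_forward ss (addn0 r) hk' F' sp'.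
  rewrite nb_involutive in a0.
  exists b, a; rewrite a0; split; split=> //.
  + case=> // p /andP [_ pb]; have [j [H1 H2]] := fl p pb; exists j.
    have -> : Posz p.+1 = 1 + Posz p by [].
    by rewrite addrA subn1.
  + move=> p; rewrite PoszD addrA; apply: (source_forward ss) => //.
    * by rewrite -addn1 addnC PoszD addrA.
    * by rewrite -addn1 addnC PoszD addrA.
  + by rewrite -addn1 addnC PoszD addrA.
Qed.

End Sequences.

(** * Paths seen from a base vertex *)

Section Paths.
Variable n : nat.
Implicit Types (c v : vert n) (s r : seq 'I_n) (i j : 'I_n) (p : seq (vert n)).

(* Seen from [c], a path first descends to its vertex closest to [c], then ascends. *)
Lemma descend_ascend (w : nat -> seq 'I_n) l :
  (forall k, (k < l)%N -> exists j, w k = j :: w k.+1 \/ w k.+1 = j :: w k) ->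
  (forall k, (k.+1 < l)%N -> w k <> w k.+2) ->
  exists m, [/\ (m <= l)%N, forall k, (k < m)%N -> exists j, w k = j :: w k.+1 &
    forall k, (m <= k < l)%N -> exists j, w k.+1 = j :: w k].
Proof.
elim: l => [|l IH] st nb.
  by exists 0%N; split=> // k; rewrite ltn0 andbF.
have [||m [ml dn up]] := IH.
- by move=> k kl; apply: st; exact: ltnW.
- by move=> k kl; apply: nb; exact: ltnW.
have [j [E|E]] := st l (ltnSn l); last first.
  exists m; split=> //; first exact: leqW.
  move=> k /andP [mk]; rewrite ltnS leq_eqVlt => /orP [/eqP ->|kl]; first by exists j.
  by apply: up; rewrite mk.
move: ml; rewrite leq_eqVlt => /orP [/eqP ml|ml].
  exists l.+1; split=> // k; last by case/andP=> h /leq_trans /(_ h); rewrite ltnn.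
  rewrite ltnS leq_eqVlt => /orP [/eqP ->|kl]; first by exists j.
  by apply: dn; rewrite ml.
(* A descent right after an ascent would return to the vertex visited two steps earlier. *)
case: l => [|l] // in st nb up ml E {IH} *.
have [|j' E'] := up l; first by rewrite -ltnS ml ltnSn.
by case: (nb l) => //; move: E; rewrite E' => -[].
Qed.

(** At index [m] the path is closest to [c]. If it misses [c], all its words extend the nonempty
    word [w m] and share its branch; if it crosses [c], equal branches would mean backtracking
    there. *)
Lemma path_shape c p l : is_path p -> size p = l.+1 ->
  let w k := coord c (nth (troot n) p k) in
  exists m, (m <= l)%N /\ [/\ forall k, (k <= m)%N -> (size (w k) + k)%N = size (w 0),
    forall k, (m <= k <= l)%N -> size (w k) = (size (w m) + (k - m))%N,
    forall k, (k < m)%N -> branch (w k) = branch (w 0),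
    forall k, (m < k <= l)%N -> branch (w k) = branch (w l) &
    if w m == [::] then (0 < m < l)%N -> branch (w 0) <> branch (w l)
    else branch (w 0) = branch (w l)].
Proof.
move=> [_ adjp nbp] zp w.
have [k kl|k kl|m [ml dn up]] := @descend_ascend w l.
- by apply: coord_adj; apply: adjp; rewrite zp ltnS.
- move=> E; have := nbp k; rewrite zp ltnS => /(_ kl) /eqP; apply.
  by rewrite -[LHS](walk_coord c) -/(w k) E walk_coord.
have sdn k : (k <= m)%N -> (size (w k) + k)%N = size (w 0).
  elim: k => [|k IH] km; first by rewrite addn0.
  by rewrite -IH 1?ltnW //; have [j ->] := dn k km; rewrite /= addSnnS.
have sup k : (m + k <= l)%N -> size (w (m + k)%N) = (size (w m) + k)%N.
  elim: k => [|k IH] km; first by rewrite !addn0.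
  rewrite !addnS in km *; have [|j ->] := up (m + k)%N; first by rewrite leq_addr.
  by rewrite /= IH // ltnW.
have bdn k : (k < m)%N -> branch (w k) = branch (w 0).
  elim: k => // k IH km; rewrite -IH 1?ltnW //.
  have [j ->] := dn k (ltnW km); have [j' E] := dn k.+1 km.
  by rewrite branch_cons // E.
have bup k : (m + k.+1 <= l)%N -> branch (w (m + k.+1)%N) = branch (w m.+1).
  elim: k => [|k IH] km; first by rewrite addn1.
  rewrite -IH; last by apply: leq_trans km; rewrite !addnS.
  have [|j] := up (m + k.+1)%N; first by rewrite leq_addr -addnS.
  rewrite -addnS => ->; rewrite branch_cons // addnS.
  have [|j' ->] // := up (m + k)%N.
  by rewrite leq_addr; apply: leq_trans km; rewrite !addnS.
have bup' k : (m < k <= l)%N -> branch (w k) = branch (w m.+1).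
  move=> /andP [mk kl]; have E : k = (m + (k - m.+1).+1)%N.
    by rewrite -addSnnS subnKC.
  by rewrite E; apply: bup; rewrite -E.
exists m; split=> //; split.
- exact: sdn.
- by move=> k /andP [mk kl]; rewrite -sup ?subnKC.
- exact: bdn.
- move=> k mkl; rewrite (bup' k mkl) (bup' l) // leqnn andbT.
  by case/andP: mkl; exact: leq_trans.
case: eqP => [w0 /andP [m0 mlt]|/eqP wn].
- case: m => // m in w0 m0 mlt ml dn up sdn sup bdn bup bup' *.
  rewrite -(bdn m) // (bup' l) ?mlt ?leqnn //.
  have [j E] := dn m (ltnSn m); rewrite w0 in E.
  have [|j' E'] := up m.+1; first by rewrite leqnn.
  rewrite w0 in E'; rewrite E E' => -[jj].
  have := nbp m; rewrite zp ltnS => /(_ mlt) /eqP; apply.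
  by rewrite -[LHS](walk_coord c) -/(w m) E jj -E' walk_coord.
- have -> : branch (w 0) = branch (w m).
    case: m => // m in wn dn bdn {ml up sdn sup bup bup'} *.
    by rewrite -(bdn m) //; have [j ->] := dn m (ltnSn m); rewrite branch_cons.
  move: ml; rewrite leq_eqVlt => /orP [/eqP -> //|ml].
  rewrite (bup' l) ?ml ?leqnn //; have [|j ->] := up m; first by rewrite leqnn.
  by rewrite branch_cons.
Qed.

Lemma is_path_size p : is_path p -> exists l, size p = l.+1.
Proof. by move=> [h _ _]; exists (size p).-1; rewrite prednK. Qed.

Lemma path_exists u v : exists p, [/\ is_path p, nth (troot n) p 0 = u &
  nth (troot n) p (size p).-1 = v].
Proof.
set r := coord u v; pose q k := walk u (drop (size r - k) r).
have hr : reduced r by exact: coord_reduced.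
have hd d : reduced (drop d r).
  by have := hr; rewrite -{1}(cat_take_drop d r) => /cat_sorted2 [].
exists (mkseq q (size r).+1); rewrite size_mkseq /=; split.
- split; rewrite ?size_mkseq //.
  + move=> k kr; rewrite !nth_mkseq //; last exact: ltnW.
    case: r hr hd @q kr => // i r hr hd q kr; rewrite ltnS in kr.
    have E : (size (i :: r) - k = (size (i :: r) - k.+1).+1)%N.
      by rewrite subnSK.
    rewrite /q E [in X in adj _ X](drop_nth i) /=; last by rewrite -subSn // subSS leq_subr.
    by rewrite adj_sym /= adj_nb.
  + move=> k kr; rewrite (nth_mkseq _ _ (ltnW (ltnW kr))) (nth_mkseq _ _ kr).
    apply/eqP => /(walk_inj (hd _) (hd _)) /(congr1 size); rewrite !size_drop.
    by move: kr; clear; move: (size _) => x; lia.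
- by rewrite /q subn0 drop_size.
- by rewrite nth_mkseq // /q subnn drop0 walk_coord.
Qed.

End Paths.

(** * Diameter paths of convex vertex sets *)

Section Support.
Variables (n : nat) (S : pred (vert n)).
Implicit Types (c v : vert n) (s r : seq 'I_n) (i j : 'I_n) (p q : seq (vert n)).

(** Path convexity, in the form that indecomposability yields: no missing vertex separates two
    vertices of [S]. *)
Definition convex : Prop := forall w u v, S u -> S v -> ~~ S w ->
  branch (coord w u) = branch (coord w v).

Lemma convex_path p : convex -> is_path p -> S (nth (troot n) p 0) ->
  S (nth (troot n) p (size p).-1) -> forall v, v \in p -> S v.
Proof.
move=> cS pp S0 Sl v vp; apply: contraT => nSv.
have [l zp] := is_path_size pp.
have [m [ml [sdn sup _ _]]] := path_shape v pp zp.
have [k kl E] : exists2 k, (k <= l)%N & nth (troot n) p k = v.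
  by exists (index v p); rewrite ?nth_index // -ltnS -zp index_mem.
have vv : coord v v = [::] by rewrite -{2}[v]/(walk v [::]) coord_walk.
have km : k = m.
  case: (leqP k m) => km.
    have := sdn k km; have := sdn m (leqnn m); rewrite E vv /=.
    by move: km; clear; move: (size _) (size _) => a b; lia.
  have := sup k; rewrite (ltnW km) kl E vv /= => /(_ isT).
  by move: km; clear; move: (size _) => a /=; lia.
rewrite -km E vv eqxx => H; rewrite zp /= in Sl; case: H; last exact: cS.
rewrite lt0n; apply/andP; split.
  by apply/eqP => k0; rewrite -k0 km in S0 *; rewrite -km E (negbTE nSv) in S0.
rewrite ltn_neqAle kl andbT; apply/eqP => k0.
by rewrite -k0 E (negbTE nSv) in Sl.
Qed.

Variables (k : fieldType) (M : rep k n).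
Hypothesis SM : forall v, S v = (rdim M v != 0%N).
Hypothesis cS : convex.

Lemma in_suppE p : in_supp M p <-> forall v, v \in p -> S v.
Proof. by split=> H v /H; rewrite SM. Qed.

Lemma supp_path s r c : reduced s -> reduced r -> S (walk c s) -> S (walk c r) ->
  branch s != branch r \/ s = [::] /\ r = [::] ->
  exists q, [/\ is_path q, in_supp M q & size q = (size s + size r).+1].
Proof.
move=> hs hr Ss Sr br; have [q [pq q0 ql]] := path_exists (walk c s) (walk c r).
exists q; split=> //.
  by apply/in_suppE; apply: convex_path => //; rewrite ?q0 ?ql.
have [l zq] := is_path_size pq.
rewrite zq /= in ql.
have [m [ml [sdn sup _ _]]] := path_shape c pq zq.
have := sdn m (leqnn m); have := sup l; rewrite ml leqnn q0 ql !coord_walk //.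
move=> /(_ isT) -> <-; case: eqP => [-> _|wn H].
  by rewrite zq /= add0n subnKC.
case: br => [/eqP //|[s0 _]]; move/eqP: (sdn m (leqnn m)).
by rewrite q0 coord_walk // s0 addn_eq0 size_eq0 (negbTE (introN eqP wn)).
Qed.

(** The length of a path is the sum of the distances of its ends from [c], minus twice its own
    distance from [c]. Length [2 R] forces it through [c] halfway. *)
Lemma even_path c R p : even_state S c R -> is_path p -> in_supp M p ->
  (size p <= (2 * R).+1)%N /\ (size p = (2 * R).+1 ->
     [/\ nth (troot n) p R = c, size (coord c (head (troot n) p)) = R &
      size (coord c (last (troot n) p)) = R]).
Proof.
move=> [ball _] pp /in_suppE Sp.
have [l zp] := is_path_size pp.
have [m [ml [sdn sup _ _]]] := path_shape c pp zp.
have B x : (x <= l)%N -> (size (coord c (nth (troot n) p x)) <= R)%N.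
  move=> xl; apply: ball; first exact: coord_reduced.
  by rewrite walk_coord; apply: Sp; rewrite mem_nth // zp ltnS.
have B0 := B 0%N (leq0n _); have Bl := B l (leqnn l).
have sm := sdn m (leqnn m); have sl := sup l; rewrite ml leqnn in sl; have {}sl := sl isT.
rewrite -nth0 -nth_last zp /=.
have key : (l <= 2 * R)%N /\ (l = (2 * R)%N -> [/\ m = R,
   size (coord c (nth (troot n) p m)) = 0%N,
   size (coord c (nth (troot n) p 0)) = R & size (coord c (nth (troot n) p l)) = R]).
  move: ml sm sl B0 Bl; clear.
  move: (size _) (size _) (size _) => x y z ml sm sl B0 Bl.
  split=> [|E]; first by lia.
  by split; lia.
case: key => lR key; split=> // -[lE]; have [mR /eqP w0 s0 sl'] := key lE; split=> //.
by rewrite -mR -[LHS](walk_coord c); move: w0; rewrite size_eq0 => /eqP ->.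
Qed.

Lemma even_diam c R : even_state S c R ->
  (exists p, diam_path M p) /\
  forall p, diam_path M p -> [/\ size p = (2 * R).+1, nth (troot n) p R = c,
    size (coord c (head (troot n) p)) = R & size (coord c (last (troot n) p)) = R].
Proof.
move=> E; have [ball [s [r [[hs hr Ss Sr] [zs zr sr]]]]] := E.
have [q [pq Sq zq]] : exists q, [/\ is_path q, in_supp M q & size q = (2 * R).+1].
  have [|q [pq Sq zq]] := supp_path hs hr Ss Sr.
  - case/orP: sr => [/eqP R0|]; last by left.
    by right; rewrite R0 in zs zr; split; apply/nilP; rewrite /nilp ?zs ?zr.
  - by exists q; split=> //; rewrite zq zs zr mul2n addnn.
have sizeE p : diam_path M p -> size p = (2 * R).+1.
  move=> [pp Sp mp]; apply/eqP; rewrite eqn_leq -{2}zq mp // andbT.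
  by case: (even_path E pp Sp).
split.
  exists q; split=> // q' pq' Sq'; rewrite zq.
  by case: (even_path E pq' Sq').
move=> p dp; have zp := sizeE p dp; case: dp => pp Sp _.
by have [_ /(_ zp) []] := even_path E pp Sp.
Qed.

(** A path missing [c] has length at most [2 R]: its ends are within [R + 1] and it stays at
    distance at least 1. Longer paths cross [c]. *)
Lemma flow_path c i R p : flow_state S c i R -> is_path p -> in_supp M p ->
  (size p <= (2 * R).+2)%N /\ (size p = (2 * R).+2 ->
     (nth (troot n) p R == c) && (nth (troot n) p R.+1 == nb c i) ||
     (nth (troot n) p R == nb c i) && (nth (troot n) p R.+1 == c)).
Proof.
move=> [ball _ _] pp /in_suppE Sp.
have [l zp] := is_path_size pp.
have [m [ml [sdn sup bdn bup wm]]] := path_shape c pp zp.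
have B x : (x <= l)%N -> (size (coord c (nth (troot n) p x))
    <= R + (branch (coord c (nth (troot n) p x)) == Some i))%N.
  move=> xl; apply: ball; first exact: coord_reduced.
  by rewrite walk_coord; apply: Sp; rewrite mem_nth // zp ltnS.
have B0 := B 0%N (leq0n _); have Bl := B l (leqnn l).
have sm := sdn m (leqnn m); have sl := sup l; rewrite ml leqnn in sl; have {}sl := sl isT.
rewrite zp; case: eqP wm => [w0 wm|/eqP wn wE]; last first.
  have : (0 < size (coord c (nth (troot n) p m)))%N by rewrite lt0n size_eq0.
  have lt : forall x y z (b1 b2 : bool), (0 < x)%N -> (m <= l)%N -> (x + m = y)%N ->
      z = (x + (l - m))%N -> (y <= R + b1)%N -> (z <= R + b2)%N -> (l < (2 * R).+1)%N.
    by clear=> x y z [] [] /=; lia.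
  move=> w1; have lR := lt _ _ _ _ _ w1 ml sm sl B0 Bl.
  by split; [exact: leqW | case=> E; rewrite E ltnn in lR].
rewrite w0 /= add0n in sm sl.
(* The two ends lie in different branches at [c], so at most one of them is beyond [nb c i]. *)
have nn : ~~ ((branch (coord c (nth (troot n) p 0)) == Some i) &&
              (branch (coord c (nth (troot n) p l)) == Some i)).
  apply/negP => /andP [/eqP b0 /eqP bl]; apply: wm; last by rewrite b0 bl.
  rewrite !lt0n; apply/andP; split.
    by apply/eqP => m0; move: b0; rewrite -m0 w0.
  by rewrite ltn_neqAle ml andbT; apply/eqP => m0; move: bl; rewrite -m0 w0.
have pm : nth (troot n) p m = c by rewrite -[LHS](walk_coord c) w0.
have nbr x : size (coord c (nth (troot n) p x)) = 1%N ->
    branch (coord c (nth (troot n) p x)) = Some i -> nth (troot n) p x = nb c i.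
  move=> s1 bi; rewrite -[LHS](walk_coord c).
  by case: (coord _ _) s1 bi => [|y []] //= _ [->].
case b0: (branch (coord c (nth (troot n) p 0)) == Some i) nn B0 => nn B0;
  case bl: (branch (coord c (nth (troot n) p l)) == Some i) nn Bl => // _ Bl.
- split; first by move: ml sm sl B0 Bl; clear=> ? <- ->; rewrite addn1; lia.
  case=> lE; have mE : m = R.+1 by move: ml sm sl B0 Bl lE; clear=> ? <- -> /=; lia.
  have s1 := sdn R; rewrite mE leqnSn in s1.
  rewrite -mE pm eqxx andbT; apply/orP; right; apply/eqP/nbr.
    by move: (s1 isT) sm; rewrite mE; clear=> <-; lia.
  by rewrite bdn ?mE //; apply/eqP.
- split; first by move: ml sm sl B0 Bl; clear=> ? <- -> /=; lia.
  case=> lE; have mE : m = R by move: ml sm sl B0 Bl lE; clear=> ? <- -> /=; lia.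
  have lR : (m < R.+1 <= l)%N by rewrite mE lE; clear; lia.
  have s1 := sup R.+1; rewrite w0 (ltnW (proj1 (andP lR))) (proj2 (andP lR)) in s1.
  rewrite -{1}mE pm eqxx; apply/orP; left; apply/eqP/nbr.
    by rewrite (s1 isT) mE subSnn.
  by rewrite bup //; apply/eqP.
- split; first by move: ml sm sl B0 Bl; clear=> ? <- -> /=; lia.
  by case=> lE; move: ml sm sl B0 Bl lE; clear=> ? <- -> /=; lia.
Qed.

Lemma flow_diam c i R : flow_state S c i R ->
  (exists p, diam_path M p) /\
  forall p, diam_path M p -> size p = (2 * R).+2 /\
     ((nth (troot n) p R == c) && (nth (troot n) p R.+1 == nb c i) ||
     (nth (troot n) p R == nb c i) && (nth (troot n) p R.+1 == c)).
Proof.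
move=> E; have [ball [s [hs Ss bs zs]] [r [hr Sr br zr]]] := E.
have [q [pq Sq zq]] : exists q, [/\ is_path q, in_supp M q & size q = (2 * R).+2].
  have [|q [pq Sq zq]] := supp_path hs hr Ss Sr.
    by left; rewrite bs eq_sym.
  by exists q; split=> //; rewrite zq zs zr addSn addnn mul2n.
have sizeE p : diam_path M p -> size p = (2 * R).+2.
  move=> [pp Sp mp]; apply/eqP; rewrite eqn_leq -{2}zq mp // andbT.
  by case: (flow_path E pp Sp).
split.
  exists q; split=> // q' pq' Sq'; rewrite zq.
  by case: (flow_path E pq' Sq').
move=> p dp; have zp := sizeE p dp; split=> //; case: dp => pp Sp _.
by have [_ /(_ zp)] := flow_path E pp Sp.
Qed.

End Support.

(** * From vertex sets back to modules *)

Section ShiftOrbits.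
Variables (k : fieldType) (n : nat).

Definition supp (M : rep k n) : pred (vert n) := fun a => rdim M a != 0%N.

(** Passing from one branch at [w] to another requires crossing [w], so lying in a given branch is
    constant along edges of the support. *)
Lemma indec_convex (M : rep k n) : indec M -> convex (supp M).
Proof.
move=> iM w u v Su Sv nSw; apply/esym/eqP.
apply: (indec_closed (P := fun a => branch (coord w a) == branch (coord w u)) iM _ Su Sv) => //.
have nw a : rdim M a != 0%N -> coord w a != [::].
  apply: contraNneq => E; suff -> : a = w by rewrite negbK in nSw.
  by rewrite -[LHS](walk_coord w) E.
move=> a b ab /nw na /nw nb /eqP <-.
have [j [E|E]] := coord_adj w ab; rewrite E branch_cons //.
Qed.

(** At a sink the dimensions in [M] and [N] add up to the sum over the neighbours, so one side
    vanishes iff the other does. *)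
Lemma ses_step (M N : rep k n) : ses M N ->
  step (supp M) (supp N) (is_sink (rorient M)).
Proof.
move=> s a; split=> ha; rewrite /supp.
  by rewrite (ses_dim_source s ha).
rewrite -negb_and -addn_eq0 addnC (ses_dim_sink s ha) sum_nat_eq0 negb_forall.
by apply: eq_existsb => j; rewrite negb_imply.
Qed.

Lemma regular_shift_seq (M : rep k n) : regular M ->
  shift_seq (fun t => supp (shift_int M t)) (fun t => is_sink (rorient (shift_int M t))).
Proof.
move=> rM; split=> [t a i|t a|t]; first exact: is_sink_nb.
- by have [g [h s]] := ses_shift rM t; rewrite (ses_orient s) is_sinkN.
- exact: ses_step (ses_shift rM t).
Qed.

Lemma is_sink_coord o c (a : vert n) : is_sink o a = is_sink o c (+) odd (size (coord c a)).
Proof.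
rewrite -{1}(walk_coord c a) (@alternating_walk _ (is_sink o)) //.
by move=> ? ?; exact: is_sink_nb.
Qed.

Section ModuleStates.
Variables (M : rep k n) (S : pred (vert n)).
Hypothesis SM : forall v, S v = (rdim M v != 0%N).
Hypothesis cS : convex S.

Lemma even_state_sink c R : even_state S c R -> is_sink (rorient M) c = ~~ odd R ->
  sink_module M R /\ vcenter M R c.
Proof.
move=> E hc; have [ex dp] := even_diam SM cS E; split; last by move=> p /dp [].
by split=> // p /dp [zp _ hp lp]; rewrite (is_sink_coord _ c (head _ _)) hp (is_sink_coord _ c (last _ _)) lp hc addNb addbb.
Qed.

Lemma even_state_source c R : even_state S c R -> is_sink (rorient M) c = odd R ->
  source_module M R /\ vcenter M R c.
Proof.
move=> E hc; have [ex dp] := even_diam SM cS E; split; last by move=> p /dp [].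
by split=> // p /dp [zp _ hp lp]; rewrite (is_sink_coord _ c (head _ _)) hp (is_sink_coord _ c (last _ _)) lp hc addbb.
Qed.

Lemma flow_state_flow c i R : flow_state S c i R ->
  flow_module M R /\ ecenter M R (nb c i) c.
Proof.
move=> F; have [ex dp] := flow_diam SM cS F; split; last first.
  by move=> p /dp [_]; rewrite orbC.
by split=> // p /dp [].
Qed.

End ModuleStates.

Lemma sink_not_source (M : rep k n) r r' : sink_module M r -> ~ source_module M r'.
Proof.
move=> [[p dp] H] [_ /(_ p dp) [_ h _]].
by have [_ h' _] := H p dp; rewrite h' in h.
Qed.

Lemma sink_not_flow (M : rep k n) r r' : sink_module M r -> ~ flow_module M r'.
Proof.
move=> [[p dp] H] [_ /(_ p dp) E].
by have [E' _ _] := H p dp; move/(congr1 odd): E; rewrite E' /= !oddM.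
Qed.

Lemma sink_radius (M : rep k n) r r' : sink_module M r -> sink_module M r' -> r = r'.
Proof.
move=> [[p dp] H] [_ /(_ p dp) [E _ _]].
have [E' _ _] := H p dp; apply/eqP; rewrite -(eqn_pmul2l (m := 2)) //.
by rewrite -eqSS -E' E.
Qed.

End ShiftOrbits.

Theorem theorem1 (k : fieldType) (n : nat) (M : rep k n) :
  (3 <= n)%N -> finsupp M -> regular M ->
  exists (t0 : int) (r0 b : nat) (a : seq (vert n)),
    let M0 := shift_int M t0 in
    let Mi := fun i : int => shift_int M0 i in
    (* M0 is the unique sink module of smallest radius in the shift orbit *)
    sink_module M0 r0 /\
    (forall (t : int) (r : nat), sink_module (shift_int M t) r ->
        (r0 <= r)%N /\ (r = r0 -> t = t0)) /\
    (1 <= r0)%N /\ (b <= r0)%N /\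
    size a = b.+1 /\ is_path a /\
    (* (1) *)
    (forall i : nat, sink_module (Mi (- Posz i)%R) (r0 + i)
                     /\ vcenter (Mi (- Posz i)%R) (r0 + i) (nth (troot n) a 0)) /\
    (* (2) *)
    (forall i : nat, (1 <= i <= b)%N ->
        flow_module (Mi (Posz i)) (r0 - 1)
        /\ ecenter (Mi (Posz i)) (r0 - 1) (nth (troot n) a i.-1) (nth (troot n) a i)) /\
    (* (3) *)
    (forall i : nat, source_module (Mi (Posz (b.+1 + i)%N)) (r0 + i)
                     /\ vcenter (Mi (Posz (b.+1 + i)%N)) (r0 + i) (nth (troot n) a b)) /\
    (* a_0 is a sink of M0's orientation iff r0 is even *)
    is_sink (rorient M0) (nth (troot n) a 0) = ~~ odd r0.
Proof.
move=> hn [l fin] rM.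
have ss := regular_shift_seq rM.
have ne0 : exists v, supp (shift_int M 0) v.
  apply: NNPP => no; case: rM => -[nz _] _; apply: nz => a.
  by apply/eqP/negPn/negP => ha; apply: no; exists a.
have [t0 [r0 [b [a [[r0p br za pa] [back snk0 fl fwd snkb]]]]]] :=
  shift_seq_orbit hn ss (l := l) fin ne0.
have cS t : convex (supp (shift_int M t)) by apply: indec_convex; exact: indec_shift.
have tr i : iso (shift_int M (t0 + i)) (shift_int (shift_int M t0) i).
  exact: iso_shift_shift.
have trS i v : supp (shift_int M (t0 + i)) v = (rdim (shift_int (shift_int M t0) i) v != 0%N).
  by rewrite /supp (iso_dim (tr i)).
(* An arbitrary [N] with the right orientation and support covers both the terms of the given orbit,
   needed for uniqueness, and the twice shifted [Mi], only isomorphic to them. *)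
have sinks (i : nat) (N : rep k n) : rorient N = rorient (shift_int M (t0 - Posz i)) ->
    (forall v, supp (shift_int M (t0 - Posz i)) v = (rdim N v != 0%N)) ->
    sink_module N (r0 + i) /\ vcenter N (r0 + i) (nth (troot n) a 0).
  move=> oN SN; apply: (even_state_sink SN (cS _) (back i)).
  rewrite oN; have := snk_add ss (t0 - Posz i) i (nth (troot n) a 0).
  by rewrite subrK snk0 oddD; case: (is_sink _ _); case: (odd i); case: (odd r0).
have flows (i : nat) (N : rep k n) :
    (forall v, supp (shift_int M (t0 + Posz i)) v = (rdim N v != 0%N)) -> (1 <= i <= b)%N ->
    flow_module N (r0 - 1) /\ ecenter N (r0 - 1) (nth (troot n) a i.-1) (nth (troot n) a i).
  move=> SN hi; have [j [F ->]] := fl i hi.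
  exact: (flow_state_flow SN (cS _) F).
have sources (i : nat) (N : rep k n) :
    rorient N = rorient (shift_int M (t0 + Posz (b.+1 + i)%N)) ->
    (forall v, supp (shift_int M (t0 + Posz (b.+1 + i)%N)) v = (rdim N v != 0%N)) ->
    source_module N (r0 + i) /\ vcenter N (r0 + i) (nth (troot n) a b).
  move=> oN SN; apply: (even_state_source SN (cS _) (fwd i)).
  rewrite oN PoszD addrA (snk_add ss) snkb oddD; by [].
exists t0, r0, b, a => M0 Mi; split.
  by have := sinks 0%N M0; rewrite subr0 addn0 => /(_ (erefl _) (fun v => erefl _)) [].
split.
  (* Up to [t0] the radius is [r0 + (t0 - t)]; afterwards only flow and source modules occur, and
     these are never sink modules. *)
  move=> t r hs; case: (lerP 0 (t0 - t)) => h.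
  - have [i E] : exists i : nat, t = t0 - Posz i.
      by exists `|t0 - t|%N; rewrite gez0_abs // subKr.
    have [hs' _] := sinks i _ (erefl _) (fun v => erefl _).
    rewrite E in hs *; rewrite (sink_radius hs hs').
    split; first exact: leq_addr.
    by rewrite -{2}[r0]addn0 => /addnI ->; rewrite subr0.
  - have [i E] : exists i : nat, t = t0 + Posz i.+1.
      exists (`|t - t0|.-1)%N; rewrite prednK; last by rewrite absz_gt0; move: h; clear; lia.
      by rewrite gez0_abs; move: h; clear; lia.
    rewrite E in hs; exfalso; case: (leqP i.+1 b) => ib.
    + have [fm _] := flows i.+1 _ (fun v => erefl _) ib.
      exact: sink_not_flow hs fm.
    + have Ei : i.+1 = (b.+1 + (i.+1 - b.+1))%N by rewrite subnKC.
      rewrite Ei in hs; have [sm _] := sources (i.+1 - b.+1)%N _ (erefl _) (fun v => erefl _).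
      exact: sink_not_source hs sm.
do 4!split=> //; split; last split; last split.
- by move=> i; apply: sinks => //; case: (tr (- Posz i)).
- by move=> i hi; apply: flows.
- by move=> i; apply: sources => //; case: (tr (Posz (b.+1 + i)%N)).
- exact: snk0.
Qed.
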